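(* Let $M\ge 1$, $L_1,\dots,L_M\in\mathbb{N}=\{1,2,\dots\}$, and $q_1,\dots,q_M\in\mathbb{R}[x]$ with $\deg q_j<2L_j$ and $q_j(0)=0$ for each $j$. Let $$P(x,y)=\prod_{j=1}^{M}\bigl(y+q_j(x)+i x^{2L_j}\bigr).$$ Let $1\le \mathfrak{p}<\infty$ and $Q\in\mathbb{C}\{x,y\}$. Then $Q\in\mathcal{I}^{\mathfrak{p}}_P$ if and only if for every $j=1,\dots,M$, $$O(2L_j,q_j,Q)\ \ge\ \sum_{i=1}^{M}O_{ij}-\left\lceil\frac{2L_j+1}{\mathfrak{p}}\right\rceil+1 .$$
   Context: $\mathbb{C}\{x,y\}$ denotes the ring of convergent power series in $(x,y)$ centered at $(0,0)$. A function $f$ is in $L^{\mathfrak{p}}_{loc}$ if it is defined on some neighborhood $U$ of $(0,0)$ in $\mathbb{R}^2$ and belongs to $L^{\mathfrak{p}}(U)$ with respect to Lebesgue measure. For a function $P$, $\mathcal{I}^{\mathfrak{p}}_P=\{Q\in\mathbb{C}\{x,y\}: Q/P\in L^{\mathfrak{p}}_{loc}\}$. For $Q\in\mathbb{C}\{x,y\}$, $q\in\mathbb{C}[x]$, $n\in\mathbb{N}$, $O(n,q,Q)$ denotes the largest $k$ such that $x^k$ divides $Q(x,x^ny-q(x))$. ''Ord'' of a one-variable power series is its order of vanishing at $0$. Given data $L_1,\dots,L_M$, $q_1,\dots,q_M$, define $O_{ij}=\min\{\mathrm{Ord}(q_j-q_i),2L_j,2L_i\}$ (so $O_{jj}=2L_j$).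 *)

(* Defs.v *)
From HB Require Import structures.
From mathcomp Require Import all_boot all_order all_algebra.
From mathcomp Require Import all_classical all_reals all_analysis.
From mathcomp Require Import complex.
Set Implicit Arguments. Unset Strict Implicit. Unset Printing Implicit Defensive.
Import Order.TTheory GRing.Theory Num.Theory.
Local Open Scope ring_scope.
Local Open Scope complex_scope.
Local Open Scope classical_set_scope.

(* A (formal) double power series in (x,y) with complex coefficients
   c i j = coefficient of x^i y^j. *)
Definition cpseries (R : realType) := nat -> nat -> R[i].

Definition cmod (R : realType) (z : R[i]) : R := Num.sqrt (complex.Re z ^+ 2 + complex.Im z ^+ 2).

(* Membership in C{x,y}: the series converges absolutely on some polydisc
   of radius r > 0. *)
Definition ps_convergent (R : realType) (c : cpseries R) : Prop :=
  exists r : R, 0 < r /\ exists B : R, forall N : nat,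
    \sum_(i < N) \sum_(j < N) cmod (c i j) * r ^+ (i + j) <= B.

Definition ps_eval (R : realType) (c : cpseries R) (x y : R) : R[i] :=
  Complex
    (limn (fun N : nat => \sum_(i < N) \sum_(j < N) complex.Re (c i j) * x ^+ i * y ^+ j))
    (limn (fun N : nat => \sum_(i < N) \sum_(j < N) complex.Im (c i j) * x ^+ i * y ^+ j)).

Definition Lp_loc (R : realType) (p : R)
    (f : (R * R)%type -> R[i]) : Prop :=
  exists U : set (R * R)%type,
    (exists e : R, 0 < e /\ [set z | `|z.1| < e /\ `|z.2| < e] `<=` U) /\
    measurable U /\
    measurable_fun U (fun z => complex.Re (f z)) /\
    measurable_fun U (fun z => complex.Im (f z)) /\
    (\int[(@lebesgue_measure R \x @lebesgue_measure R)%E]_(z in U) ((cmod (f z)) `^ p)%:E < +oo)%E.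

Definition xpow_divides (R : realType) (k n : nat) (q : {poly R}) (Q : cpseries R)
  : Prop :=
  exists G : cpseries R, ps_convergent G /\
    exists e : R, 0 < e /\ forall x y : R, `|x| < e -> `|y| < e ->
      ps_eval Q x (x ^+ n * y - q.[x]) = (x ^+ k)%:C * ps_eval G x y.

Definition Onq (R : realType) (n : nat) (q : {poly R}) (Q : cpseries R) : \bar R :=
  ereal_sup [set (k%:R)%:E | k in [set k : nat | xpow_divides k n q Q]].

(* Order of vanishing at 0 of a nonzero polynomial: index of the first nonzero
   coefficient. *)
Definition ordp (R : realType) (p : {poly R}) : nat := find (fun a => a != 0) p.

(* O_ij = min{Ord(q_j - q_i), 2L_j, 2L_i}, with Ord(0) = +oo. *)
Definition Oij (R : realType) (M : nat) (L : 'I_M -> nat) (q : 'I_M -> {poly R})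
  (i j : 'I_M) : nat :=
  if q j - q i == 0 then minn (2 * L j) (2 * L i)
  else minn (ordp (q j - q i)) (minn (2 * L j) (2 * L i)).

Definition Pval (R : realType) (M : nat) (L : 'I_M -> nat) (q : 'I_M -> {poly R})
  (x y : R) : R[i] :=
  \prod_(j < M) ((y + (q j).[x]) +i* (x ^+ (2 * L j))).

(* Main.v *)
Require Import Defs.
From HB Require Import structures.
From mathcomp Require Import all_boot all_order all_algebra.
From mathcomp Require Import all_classical all_reals all_analysis.
From mathcomp Require Import measurable_realfun.
From mathcomp Require Import complex lra ring zify.
Set Implicit Arguments.
Unset Strict Implicit.
Unset Printing Implicit Defensive.
Import Order.TTheory GRing.Theory Num.Theory.
Import numFieldTopology.Exports numFieldNormedType.Exports.
Local Open Scope ring_scope.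
Local Open Scope classical_set_scope.

(** Let [u_j = y + q_j(x)], and let [S_j] be the sum over [i] of the [O_ij]. On
    the horn where [u_j / x^(2 L_j)] is bounded, [|P|] is at most a constant
    times [|x|^S_j], while [Q] has size [|x|^K] for generic values of this
    quotient, [K] being the order [O(2 L_j, q_j, Q)]; the horn has width
    [|x|^(2 L_j)] in [y], so integrability forces [(S_j - K) p < 2 L_j + 1],
    which is the stated inequality.

    Conversely, the same inequality is needed at every intermediate scale
    [u_j ~ x^m], [m <= 2 L_j]. If it failed at some scale, take the coarsest
    one: there the leading form of [Q] has degree less than the number of
    branches through that scale, so it vanishes to too low an order along one of
    the groups into which these branches split, and the failure propagates to
    the finer scale along that group, until it reaches the end of a branch, a
    contradiction. The inequalities at all scales bound [|Q / P|^p] near the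
    branch [j] closest to [(x, y)] by a constant times [(|x| |u_j|)^-theta] with
    [theta < 1], which is integrable.

    The real and imaginary parts of [Q] are treated separately. Polynomials in
    [x] and [y] are elements of [{poly {poly R}}], the inner variable being [x]:
    the coefficient of [x^a y^b] in [P] is [P`_b`_a]. *)

(** * Initial forms *)

Lemma drop_polyK_low (R : nzRingType) K (g : {poly R}) :
  (forall a, (a < K)%N -> g`_a = 0) -> drop_poly K g * 'X^K = g.
Proof.
move=> g0; rewrite -[RHS](poly_take_drop K).
suff -> : take_poly K g = 0 by rewrite add0r.
by apply/polyP => a; rewrite coef_take_poly coef0; case: ifP => // /g0.
Qed.

Section InitialForms.
Variable R : comNzRingType.
Implicit Types (P V : {poly {poly R}}) (r : {poly R}).

Definition weight_ge (m K : nat) P :=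
  forall a b, (a + m * b < K)%N -> P`_b`_a = 0.

(* In the weighted-homogeneous part of weight [K] of [P(x, y)], [y] having
   weight [m], put [x = 1]. *)
Definition weight_form (m K : nat) P : {poly R} :=
  \poly_(b < size P) (if (m * b <= K)%N then P`_b`_(K - m * b) else 0).

Definition weight_subst (m : nat) P : {poly {poly R}} := P \Po (('X^m)%:P * 'X).

Lemma coef_weight_form m P a b : (weight_form m (a + m * b) P)`_b = P`_b`_a.
Proof.
rewrite coef_poly leq_addl addnK; case: ltnP => // sizeP.
by rewrite (nth_default _ sizeP) coef0.
Qed.

Lemma weight_form_coef_neq0 m K P b : (weight_form m K P)`_b != 0 ->
  (m * b <= K)%N /\ P`_b`_(K - m * b) != 0.
Proof.
have [mbK|Kmb] := leqP (m * b) K;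
  first by rewrite -{1}(subnK mbK) coef_weight_form.
by rewrite coef_poly [(m * b <= K)%N]leqNgt Kmb if_same eqxx.
Qed.

Lemma weight_form_exists m P a b : P`_b`_a != 0 ->
  exists K, [/\ (K <= a + m * b)%N, weight_ge m K P & weight_form m K P != 0].
Proof.
move=> Pab; pose occurs K :=
  `[< exists a' b', (a' + m * b' = K)%N /\ P`_b'`_a' != 0 >].
have occursP a' b' : P`_b'`_a' != 0 -> occurs (a' + m * b')%N.
  by move=> Pab'; apply/asboolP; exists a', b'.
have := ex_minnP (ex_intro occurs _ (occursP _ _ Pab)).
case=> _ /asboolP[a' [b' [<- Pab']]] Kmin.
exists (a' + m * b')%N; split; first exact/Kmin/occursP.
  move=> a1 b1; case: (eqVneq P`_b1`_a1 0) => // /occursP/Kmin.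
  by rewrite leqNgt => /negbTE ->.
apply: contraNneq Pab' => form0.
by rewrite -(coef_weight_form m) form0 coef0.
Qed.

Lemma coef_weight_subst m P b : (weight_subst m P)`_b = P`_b * 'X^(m * b).
Proof.
rewrite /weight_subst comp_polyE coef_sum.
under eq_bigr => i _ do rewrite exprMn -rmorphXn -exprM coefZ coefCM coefXn
  mulr_natr mulrnAr mulrb.
rewrite -big_mkcond /=; have [bP|Pb] := ltnP b (size P).
  by rewrite (big_pred1 (Ordinal bP)).
rewrite big_pred0 ?(nth_default _ Pb) ?mul0r // => i.
by apply: contraTF (ltn_ord i) => /eqP <-; rewrite -leqNgt.
Qed.

Lemma weight_subst_factor m K P :
  weight_ge m K P -> exists V, weight_subst m P = ('X^K)%:P * V.
Proof.
move=> wP; exists (\poly_(b < size P) drop_poly K (P`_b * 'X^(m * b))).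
apply/polyP => b; rewrite coef_weight_subst coefCM coef_poly.
case: ltnP => [_|Pb]; last by rewrite mulr0 (nth_default _ Pb) mul0r.
rewrite [RHS]mulrC drop_polyK_low // => a aK.
by rewrite coefMXn; case: ltnP => // mba; apply: wP; lia.
Qed.

Lemma weight_form_factor m K P V : weight_subst m P = ('X^K)%:P * V ->
  weight_ge m K P /\ weight_form m K P = map_poly (horner_eval 0) V.
Proof.
move=> PV.
have PVb a b : (P`_b * 'X^(m * b))`_a = ('X^K * V`_b)`_a.
  by rewrite -coef_weight_subst PV coefCM.
split.
  move=> a b abK; have := PVb (a + m * b)%N b.
  by rewrite coefMXn coefXnM abK ltnNge leq_addl /= addnK.
apply/polyP => b; rewrite coef_map /= /horner_eval horner_coef0.
have := PVb K b; rewrite coefMXn coefXnM ltnn subnn => <-.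
rewrite coef_poly; case: (ltnP K) => [|_]; rewrite ?if_same //.
by case: ltnP => // Pb; rewrite (nth_default _ Pb) coef0.
Qed.

Lemma weight_form_translate m K P r : (forall a, (a < m)%N -> r`_a = 0) ->
  weight_ge m K P ->
  weight_ge m K (P \Po ('X - r%:P)) /\
  weight_form m K (P \Po ('X - r%:P)) = weight_form m K P \Po ('X - (r`_m)%:P).
Proof.
move=> r0 /weight_subst_factor[V PV]; set s := drop_poly m r.
have subst_translate :
    weight_subst m (P \Po ('X - r%:P)) = ('X^K)%:P * (V \Po ('X - s%:P)).
  rewrite -[r](drop_polyK_low r0) -/s /weight_subst -comp_polyA.
  rewrite rmorphB /= comp_polyX comp_polyC rmorphM /= [s%:P * _]mulrC -mulrBr.
  have -> : ('X^m)%:P * ('X - s%:P) = (('X^m)%:P * 'X) \Po ('X - s%:P).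
    by rewrite rmorphM /= comp_polyC comp_polyX.
  by rewrite comp_polyA -/(weight_subst m P) PV rmorphM /= comp_polyC.
have [? ->] := weight_form_factor subst_translate; split=> //.
have [_ ->] := weight_form_factor PV.
rewrite map_comp_poly /= rmorphB /= map_polyX map_polyC /= /horner_eval.
by rewrite horner_coef0 coef_drop_poly.
Qed.

End InitialForms.

Lemma prod_XsubC_dvdp (F : fieldType) (s : seq F) (g : {poly F}) :
  (forall v, v \in s -> ('X - v%:P) ^+ count_mem v s %| g) ->
  \prod_(v <- s) ('X - v%:P) %| g.
Proof.
move=> sg; rewrite -prodr_undup_exp_count.
have : {subset undup s <= s} by move=> v; rewrite mem_undup.
elim: (undup s) (undup_uniq s) => [|v t IH] /=; first by rewrite big_nil dvd1p.
move=> /andP[vt ut] ts; rewrite big_cons Gauss_dvdp.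
  by rewrite sg ?ts ?mem_head //= IH // => w wt; apply: ts; rewrite inE wt orbT.
rewrite big_seq; apply/coprimep_expl; apply: (big_ind (coprimep _)).
- by rewrite coprimep1.
- by move=> x y cx cy; rewrite coprimepMr cx.
move=> w wt; apply/coprimep_expr; rewrite coprimep_XsubC root_XsubC.
by apply: contra vt => /eqP <-.
Qed.

(** * Integrability exponents at intermediate scales *)

(* A function of size [|x|^-s] on a region of width [|x|^m] around a curve
   [y = y(x)] is in [L^p] near the origin if and only if [s * p < m + 1]. *)
Definition subcritical (R : numDomainType) (p : R) (m s : nat) : bool :=
  s%:R * p < m.+1%:R.

Section Subcritical.
Variables (R : numDomainType) (p : R).
Implicit Types m s t : nat.

Lemma subcritical0 m : subcritical p m 0.
Proof. by rewrite /subcritical mul0r ltr0n. Qed.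

Lemma subcritical_le m s t :
  0 <= p -> (s <= t)%N -> subcritical p m t -> subcritical p m s.
Proof. by move=> p0 st; apply: le_lt_trans; rewrite ler_wpM2r ?ler_nat. Qed.

Lemma subcritical_widen m s : subcritical p m s -> subcritical p m.+1 s.
Proof. by move=> /lt_le_trans; apply; rewrite ler_nat. Qed.

Lemma subcriticalS m s : 1 <= p -> subcritical p m.+1 s.+1 -> subcritical p m s.
Proof.
move=> p1; rewrite /subcritical -[s.+1%:R]natr1 mulrDl mul1r -[m.+2%:R]natr1
  -ltrBrDr.
by move=> /lt_le_trans; apply; rewrite -addrA gerDl subr_le0.
Qed.

End Subcritical.

Section Scales.
Variables (F : fieldType) (R : numDomainType) (p : R).
Variables (M : nat) (n : 'I_M -> nat) (q : 'I_M -> {poly F})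
  (O : 'I_M -> 'I_M -> nat).
Variable C : {poly {poly F}}.
Hypothesis p1 : 1 <= p.
Let p0 : 0 <= p := le_trans ler01 p1.
Hypothesis OP : forall i j m, (m <= O i j)%N <->
  [/\ (m <= n j)%N, (m <= n i)%N & forall a, (a < m)%N -> (q j)`_a = (q i)`_a].

Definition branch j := C \Po ('X - (q j)%:P).
Definition scale_sum m j := (\sum_(i < M) minn (O i j) m)%N.
Definition cluster m j := [pred i | (m <= O i j)%N].

Lemma leq_O_sym m i j : (m <= O i j)%N -> (m <= O j i)%N.
Proof. by move=> /OP[? ? qij]; apply/OP; split=> // a /qij. Qed.

Lemma leq_O_trans m i j k : (m <= O i j)%N -> (m <= O j k)%N -> (m <= O i k)%N.
Proof.
by move=> /OP[_ ? qij] /OP[? _ qjk]; apply/OP; split=> // a am;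
  rewrite qjk // qij.
Qed.

Lemma scale_sum0 j : scale_sum 0 j = 0%N.
Proof. by apply: big1 => i _; rewrite minn0. Qed.

Lemma scale_sumS m j : scale_sum m.+1 j = (scale_sum m j + #|cluster m.+1 j|)%N.
Proof.
rewrite /scale_sum -sum1_card [X in (_ + X)%N]big_mkcond -big_split /=.
by apply: eq_bigr => i _; rewrite inE; case: ifP; lia.
Qed.

Lemma scale_sum_cluster m i j :
  i \in cluster m j -> scale_sum m i = scale_sum m j.
Proof.
rewrite inE => mij; apply: eq_bigr => l _.
apply/eqP; rewrite eqn_leq !leq_min !geq_minr !andbT; apply/andP; split.
  by apply: (@leq_O_trans _ _ i);
    rewrite ?geq_minl // (leq_trans _ mij) ?geq_minr.
by apply: (@leq_O_trans _ _ j);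
  rewrite ?geq_minl // leq_O_sym // (leq_trans _ mij) ?geq_minr.
Qed.

Lemma branch_translate i j : branch i = branch j \Po ('X - (q i - q j)%:P).
Proof.
rewrite /branch -comp_polyA rmorphB /= comp_polyX comp_polyC polyCB.
by rewrite -addrA -opprD subrK.
Qed.

Lemma weight_form_cluster m i j K :
  i \in cluster m j -> weight_ge m K (branch j) ->
  weight_ge m K (branch i) /\
  weight_form m K (branch i) =
    weight_form m K (branch j) \Po ('X - ((q i - q j)`_m)%:P).
Proof.
move=> /OP[_ _ qij] wK; rewrite (branch_translate i j).
by apply: weight_form_translate => // a /qij; rewrite coefB => ->;
  rewrite subrr.
Qed.

Hypothesis end_subcritical : forall j a b, (branch j)`_b`_a != 0 ->
  subcritical p (n j) (scale_sum (n j) j - (a + n j * b)).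

Definition obstruction m j K := [/\ weight_ge m K (branch j),
  weight_form m K (branch j) != 0,
  (size (weight_form m K (branch j)) <= #|cluster m j|)%N &
  ~~ subcritical p m (scale_sum m j - K)].

Lemma obstruction_lt_end m j K i :
  obstruction m j K -> i \in cluster m j -> (m < n i)%N.
Proof.
move=> [wK nz _ ng] mij; have [_ mi _] := (OP i j m).1 mij.
rewrite ltn_neqAle mi andbT; apply: contra ng => /eqP mE.
have [_ formE] := weight_form_cluster mij wK.
have : weight_form m K (branch i) != 0
  by rewrite formE comp_poly_eq0 // size_XsubC.
rewrite -lead_coef_eq0 lead_coefE =>
  /weight_form_coef_neq0[mb /end_subcritical].
by rewrite -mE subnK // (scale_sum_cluster mij).
Qed.

(* The branches of a cluster split into groups according to their coefficient of
   [x^m]; a form of degree smaller than the size of the cluster vanishes, at the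
   point of one of the groups, to order less than the size of that group. *)
Lemma obstruction_split m j K : obstruction m j K ->
  exists2 i, i \in cluster m j & exists2 mu, (mu < #|cluster m.+1 i|)%N &
    (weight_form m K (branch i))`_mu != 0.
Proof.
move=> obs; have [wK nz size_form _] := obs; apply: contrapT => no_group.
pose v i := (q i - q j)`_m.
pose s := [seq - v i | i <- enum (cluster m j)].
suff /(dvdp_leq nz) : \prod_(x <- s) ('X - x%:P) %| weight_form m K (branch j).
  by rewrite size_prod_XsubC size_map -cardE ltnNge size_form.
apply: prod_XsubC_dvdp => _ /mapP[i + ->]; rewrite mem_enum => mij.
have -> : count_mem (- v i) s = #|cluster m.+1 i|.
  rewrite count_map -sum1_count big_enum_cond -sum1_card; apply: eq_bigl => l.
  rewrite !inE /= eqr_opp /v !coefB (inj_eq (addIr _)).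
  apply/andP/idP => [[mlj /eqP qm]|mli].
    have /OP[_ _ qil] := leq_O_trans mlj (leq_O_sym mij).
    apply/OP; rewrite (obstruction_lt_end obs mlj) (obstruction_lt_end obs mij).
    by split=> // a; rewrite ltnS leq_eqVlt => /predU1P[->|/qil].
  have /OP[_ _ qil] := mli.
  by rewrite (leq_O_trans (ltnW mli) mij) qil.
have : 'X^#|cluster m.+1 i| %| weight_form m K (branch i).
  rewrite -[weight_form m K _](@drop_polyK_low _ #|cluster m.+1 i|)
    ?dvdp_mull //.
  move=> mu mu_lt; apply/eqP/negP => /negP nzmu.
  by apply: no_group; exists i => //; exists mu.
have [_ ->] := weight_form_cluster mij wK.
move=> /(dvdp_comp_poly ('X + (v i)%:P)).
rewrite comp_Xn_poly -comp_polyA rmorphB /= comp_polyX comp_polyC addrK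
  comp_polyXr.
by rewrite rmorphN opprK.
Qed.

Lemma obstruction_step m j K :
  obstruction m j K -> exists i K', obstruction m.+1 i K'.
Proof.
move=> obs; have [wK _ _ ng] := obs.
have [i mij [mu mu_lt /weight_form_coef_neq0[mmu nzmu]]] :=
  obstruction_split obs.
have [wKi _] := weight_form_cluster mij wK.
have [K' [K'le wK' nz']] := weight_form_exists m.+1 nzmu.
have K'K : (K' <= K + mu)%N by lia.
exists i, K'; split=> //.
  apply/leq_sizeP => b Nb; apply/eqP.
  apply: contraT => /weight_form_coef_neq0[mb].
  by rewrite (wKi (K' - m.+1 * b) b)%N ?eqxx //; lia.
apply: contra ng; rewrite scale_sumS (scale_sum_cluster mij).
have [SK|KS] := leqP (scale_sum m j) K.
  by rewrite (eqP SK) subcritical0.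
move=> sub; apply: (subcriticalS p1); apply: (subcritical_le p0) sub; lia.
Qed.

Lemma no_obstruction m j K : ~ obstruction m j K.
Proof.
have scale_bound m' j' K' : obstruction m' j' K' -> (m' < \sum_i n i)%N.
  move=> obs; have [_ nz size_form _] := obs.
  have /card_gt0P[l mlj] : (0 < #|cluster m' j'|)%N.
    by apply: leq_trans size_form; rewrite size_poly_gt0.
  apply: leq_trans (obstruction_lt_end obs mlj) _.
  by rewrite (bigD1 l) //= leq_addr.
have [k le_k] := ubnP (\sum_i n i - m)%N.
elim: k m j K le_k => // k IH m j K le_k obs; have := scale_bound _ _ _ obs.
have [i [K' obs']] := obstruction_step obs => lt_m.
by apply: (IH _ _ _ _ obs'); lia.
Qed.

Lemma subcritical_scale m j a b : (m <= n j)%N -> (branch j)`_b`_a != 0 ->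
  subcritical p m (scale_sum m j - (a + m * b)).
Proof.
elim: m j a b => [|m IH] j a b mn nz; first by rewrite scale_sum0 subcritical0.
apply: contraT => ng.
have [K [Kle wK nzK]] := weight_form_exists m.+1 nz.
have {}ng : ~~ subcritical p m.+1 (scale_sum m.+1 j - K).
  by apply: contra ng; apply: subcritical_le; rewrite ?leq_sub2l.
case: (@no_obstruction m.+1 j K); split=> //.
apply/leq_sizeP => b' Nb; apply/eqP.
apply: contraNT ng => /weight_form_coef_neq0[mb nzb].
apply: subcritical_widen; apply: (subcritical_le p0) (IH j _ _ (ltnW mn) nzb).
rewrite scale_sumS; lia.
Qed.

End Scales.

(** * Absolutely convergent double series *)

Lemma sum_shift (V : nmodType) (F : nat -> V) k N :
  (forall i, (i < k)%N -> F i = 0) ->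
  \sum_(i < N) F i = \sum_(i < N) (if (i + k < N)%N then F (i + k)%N else 0).
Proof.
move=> F0.
rewrite -!(big_mkord xpredT
  (fun i => if (i + k < N)%N then F (i + k)%N else 0)).
rewrite -(big_mkord xpredT F); have [Nk|/ltnW kN] := leqP N k.
  rewrite !big_nat !big1 // => i /andP[_ iN];
    last by rewrite F0 // (leq_trans iN).
  by case: ifP => //; lia.
rewrite (big_cat_nat (n := k)) //= big_nat big1 ?add0r;
  last by move=> i /andP[_ /F0].
rewrite -{1}[k]add0n big_addn (big_nat_widen _ _ N) ?leq_subr // big_mkcond /=.
by apply: eq_bigr => i _; rewrite ltn_subRL addnC.
Qed.

Section SquareSums.
Variable V : nmodType.
Implicit Types f g : nat -> nat -> V.

Definition sqsum f (N : nat) : V := \sum_(i < N) \sum_(j < N) f i j.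

Lemma sqsumS f N :
  sqsum f N.+1 = sqsum f N + (\sum_(i < N) f i N + \sum_(j < N.+1) f N j).
Proof.
rewrite /sqsum big_ord_recr /= addrA; congr (_ + _).
by rewrite -big_split; apply: eq_bigr => i _; rewrite big_ord_recr.
Qed.

Lemma eq_sqsum f g N : (forall i j, f i j = g i j) -> sqsum f N = sqsum g N.
Proof. by move=> fg; apply: eq_bigr => i _; apply: eq_bigr => j _. Qed.

Lemma sqsum_exchange (h : nat -> nat -> nat -> nat -> V) N M :
  sqsum (fun a b => sqsum (fun i j => h a b i j) M) N =
  sqsum (fun i j => sqsum (fun a b => h a b i j) N) M.
Proof.
rewrite /sqsum; under eq_bigr => a _ do rewrite exchange_big /=.
rewrite exchange_big /=; apply: eq_bigr => i _.
under eq_bigr => a _ do rewrite exchange_big /=.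
by rewrite exchange_big.
Qed.

Lemma sqsum_stable f D N : (forall i j, (D <= maxn i j)%N -> f i j = 0) ->
  (D <= N)%N -> sqsum f N = sqsum f D.
Proof.
move=> f0 /subnK <-; elim: (N - D)%N => [|k <-] //.
rewrite addSn sqsumS !big1 ?addr0 // => i _;
  by apply: f0; rewrite leq_max leq_addl ?orbT.
Qed.

Lemma sqsum_row_shift f k N : (forall i j, (i < k)%N -> f i j = 0) ->
  sqsum f N = sqsum (fun i j => if (i + k < N)%N then f (i + k)%N j else 0) N.
Proof.
move=> f0.
rewrite /sqsum (sum_shift (F := fun i => \sum_(j < N) f i j) N (k := k)).
  by apply: eq_bigr => i _; case: ifP => // _; rewrite big1.
by move=> i ik; apply: big1 => j _; exact: f0.
Qed.

End SquareSums.

Lemma sqsumB (V : zmodType) (f g : nat -> nat -> V) N :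
  sqsum (fun i j => f i j - g i j) N = sqsum f N - sqsum g N.
Proof. by rewrite /sqsum -sumrB; apply: eq_bigr => i _; rewrite sumrB. Qed.

Lemma sqsumZ (R : pzSemiRingType) (a : R) f N :
  sqsum (fun i j => a * f i j) N = a * sqsum f N.
Proof.
by rewrite /sqsum mulr_sumr; apply: eq_bigr => i _; rewrite mulr_sumr.
Qed.

Section SquareSumInequalities.
Variable R : numDomainType.
Implicit Types f g : nat -> nat -> R.

Lemma ler_sqsum f g N : (forall i j, f i j <= g i j) -> sqsum f N <= sqsum g N.
Proof. by move=> fg; apply: ler_sum => i _; apply: ler_sum => j _. Qed.

Lemma sqsum_ge0 f N : (forall i j, 0 <= f i j) -> 0 <= sqsum f N.
Proof. by move=> f0; do 2 apply: sumr_ge0 => ? _. Qed.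

Lemma ler_norm_sqsum f N : `|sqsum f N| <= sqsum (fun i j => `|f i j|) N.
Proof.
apply: le_trans (ler_norm_sum _ _ _) _.
by apply: ler_sum => i _; exact: ler_norm_sum.
Qed.

Lemma sqsum_dist_le f g D N :
  (forall i j, (D <= maxn i j)%N -> `|f i j| <= g i j) ->
  (D <= N)%N -> `|sqsum f N - sqsum f D| <= sqsum g N - sqsum g D.
Proof.
move=> fg /subnK <-; elim: (N - D)%N => [|k IH];
  first by rewrite add0n !subrr normr0.
rewrite addSn !sqsumS addrAC [leRHS]addrAC.
apply: le_trans (ler_normD _ _) (lerD IH _).
apply: le_trans (ler_normD _ _) (lerD _ _);
  apply: le_trans (ler_norm_sum _ _ _) _;
  by apply: ler_sum => i _; apply: fg; rewrite leq_max leq_addl ?orbT.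
Qed.

End SquareSumInequalities.

Lemma cvg_big_sum (R : numFieldType) (V : pseudoMetricNormedZmodType R)
    (T I : Type) (F : set_system T) (FF : Filter F) (r : seq I)
    (f : I -> T -> V) (l : I -> V) :
  (forall i, f i x @[x --> F] --> l i) ->
  \sum_(i <- r) f i x @[x --> F] --> \sum_(i <- r) l i.
Proof.
move=> fl; rewrite -fct_sumE.
by elim/big_ind2: _ => [|u a v b|i _]; [exact: cvg_cst|exact: cvgD|exact: fl].
Qed.

Section DoubleSeries.
Variable R : realType.
Implicit Types (f g : nat -> nat -> R).

Definition dsum f : R := limn (sqsum f).

Definition dsummable f : Prop := cvgn (sqsum (fun i j => `|f i j|)).

Lemma nondecreasing_sqsum f :
  (forall i j, 0 <= f i j) -> nondecreasing_seq (sqsum f).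
Proof.
move=> f0; apply/nondecreasing_seqP => N; rewrite sqsumS lerDl addr_ge0 //;
  exact: sumr_ge0.
Qed.

Lemma sqsum_norm_le_dsum f N : dsummable f ->
  sqsum (fun i j => `|f i j|) N <= dsum (fun i j => `|f i j|).
Proof.
by move=> sf; apply: nondecreasing_cvgn_le => //; exact: nondecreasing_sqsum.
Qed.

Lemma dsummable_bound f B :
  (forall N, sqsum (fun i j => `|f i j|) N <= B) -> dsummable f.
Proof.
move=> fB; apply: nondecreasing_is_cvgn; first exact: nondecreasing_sqsum.
by exists B => _ [N _ <-].
Qed.

Lemma dsummable_le f g :
  (forall i j, `|f i j| <= `|g i j|) -> dsummable g -> dsummable f.
Proof.
move=> fg sg; apply: (@dsummable_bound _ (dsum (fun i j => `|g i j|))) => N.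
exact: le_trans (ler_sqsum N fg) (sqsum_norm_le_dsum N sg).
Qed.

Lemma sqsumZ_cvg (a : R) f : cvgn (sqsum f) ->
  sqsum (fun i j => a * f i j) N @[N --> \oo] --> a * dsum f.
Proof. by move=> cf; under eq_cvg => N do rewrite sqsumZ; exact: cvgMl_tmp. Qed.

Lemma dsumZ (a : R) f : cvgn (sqsum f) ->
  dsum (fun i j => a * f i j) = a * dsum f.
Proof. by move=> cf; apply/cvg_lim => //; exact: sqsumZ_cvg. Qed.

Lemma dsummableZ (a : R) f : dsummable f -> dsummable (fun i j => a * f i j).
Proof.
move=> sf; rewrite /dsummable.
under eq2_fun do rewrite normrM.
by apply/cvg_ex; exists (`|a| * dsum (fun i j => `|f i j|)); exact: sqsumZ_cvg.
Qed.

Lemma dsummable_cvg f : dsummable f -> cvgn (sqsum f).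
Proof.
move=> sf; pose g i j := `|f i j| + f i j.
have sg : dsummable g.
  apply: (dsummable_le _ (dsummableZ (a := 2) sf)) => i j;
    rewrite /g normrM normr_nat.
  by rewrite (le_trans (ler_normD _ _)) // normr_id; lra.
have g0 i j : 0 <= g i j by have := ler_norm (- f i j); rewrite normrN /g; lra.
have -> : sqsum f = sqsum (fun i j => `|g i j|) - sqsum (fun i j => `|f i j|).
  apply/funext => N; rewrite -[RHS]/(_ - _) -sqsumB; apply: eq_sqsum => i j.
  by rewrite ger0_norm // /g addrC addKr.
exact: is_cvgB.
Qed.

Lemma dsum_dist_le f g D :
  (forall i j, (D <= maxn i j)%N -> `|f i j| <= g i j) ->
  cvgn (sqsum f) -> cvgn (sqsum g) ->
  `|dsum f - sqsum f D| <= dsum g - sqsum g D.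
Proof.
move=> fg cf cg.
apply: (@ler_cvg_to _ \oo _ _ (fun N => `|sqsum f N - sqsum f D|)
  (fun N => sqsum g N - sqsum g D)).
- by apply: cvg_norm; apply: cvgB => //; exact: cvg_cst.
- by apply: cvgB => //; exact: cvg_cst.
by exists D => // N /= DN; exact: sqsum_dist_le.
Qed.

Lemma sqsum_dominated_cvg (f : nat -> nat -> nat -> R) (l g : nat -> nat -> R)
    (phi : nat -> nat) : dsummable g ->
  (forall n i j, `|f n i j| <= `|g i j|) ->
  (forall i j, f n i j @[n --> \oo] --> l i j) -> (forall n, (n <= phi n)%N) ->
  sqsum (f n) (phi n) @[n --> \oo] --> dsum l.
Proof.
move=> sg fg fl phi_ge.
have lg i j : `|l i j| <= `|g i j|.
  apply: (@ler_cvg_to _ \oo _ _ (fun n => `|f n i j|) (fun=> `|g i j|)) => //.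
  - by apply: cvg_norm; exact: fl.
  - exact: cvg_cst.
  - exact: nearW.
pose G := sqsum (fun i j => `|g i j|); pose G_oo := dsum (fun i j => `|g i j|).
apply/cvgrPdist_le => e e0; have e3 : 0 < e / 3 by lra.
have [D _ /(_ D (leqnn D)) /= tail_le] :
  \forall D \near \oo, `|G_oo - G D| <= e / 3.
  by move/cvgrPdist_le: sg; apply.
have {}tail_le : G_oo - G D <= e / 3 := le_trans (ler_norm _) tail_le.
have head_cvg : sqsum (f n) D @[n --> \oo] --> sqsum l D.
  by do 2 apply: cvg_big_sum => ?; exact: fl.
near=> n.
have l_tail : `|dsum l - sqsum l D| <= G_oo - G D.
  by apply: dsum_dist_le => //; apply/dsummable_cvg/(dsummable_le lg).
have f_tail : `|sqsum (f n) D - sqsum (f n) (phi n)| <= G_oo - G D.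
  rewrite distrC.
  apply: le_trans (sqsum_dist_le (g := fun i j => `|g i j|) _ _) _.
  - by move=> i j _; exact: fg.
  - by rewrite (leq_trans _ (phi_ge n)) //; near: n; exact: nbhs_infty_ge.
  - by rewrite lerD2r sqsum_norm_le_dsum.
have head : `|sqsum l D - sqsum (f n) D| <= e / 3.
  by near: n; move/cvgrPdist_le: head_cvg; apply.
have -> : dsum l - sqsum (f n) (phi n) = dsum l - sqsum l D +
    (sqsum l D - sqsum (f n) D) + (sqsum (f n) D - sqsum (f n) (phi n)) by lra.
apply: le_trans (ler_normD _ _) _;
  apply: le_trans (lerD (ler_normD _ _) (lexx _)) _.
lra.
Unshelve. all: by end_near. Qed.

End DoubleSeries.

(** * Convergent double power series *)

Section PowerSeries.
Variable R : realType.
Implicit Types (c : nat -> nat -> R) (x y r : R).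

Definition pterm c x y (i j : nat) : R := c i j * x ^+ i * y ^+ j.

Definition reval c x y : R := dsum (pterm c x y).

Definition absconv c r : Prop := dsummable (pterm c r r).

Lemma norm_pterm_le c r x y i j : `|x| <= `|r| -> `|y| <= `|r| ->
  `|pterm c x y i j| <= `|pterm c r r i j|.
Proof.
move=> xr yr; rewrite /pterm !normrM !normrX.
by rewrite !ler_pM ?mulr_ge0 ?exprn_ge0 // lerXn2r ?nnegrE.
Qed.

Lemma pterm_dsummable c r x y : absconv c r -> `|x| <= `|r| -> `|y| <= `|r| ->
  dsummable (pterm c x y).
Proof.
by move=> cr xr yr; apply: dsummable_le cr => i j; exact: norm_pterm_le.
Qed.

Lemma absconv_le c r r' : `|r'| <= `|r| -> absconv c r -> absconv c r'.
Proof. by move=> r'r cr; exact: (pterm_dsummable cr r'r r'r). Qed.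

Lemma norm_expr_le_geom r x k D : 0 < r -> `|x| <= r -> (D <= k)%N ->
  `|x| ^+ k <= r ^- D * `|x| ^+ D * r ^+ k.
Proof.
move=> r0 xr Dk.
have -> : r ^- D * `|x| ^+ D * r ^+ k = `|x| ^+ D * r ^+ (k - D).
  by rewrite -{1}(subnK Dk) exprD; field; rewrite expf_neq0 ?gt_eqF.
rewrite -{1}(subnK Dk) exprD mulrC ler_wpM2l ?exprn_ge0 //.
by rewrite lerXn2r ?nnegrE // ltW.
Qed.

Lemma norm_pterm_high_le c r x y D i j : 0 < r -> `|x| <= r -> `|y| <= r ->
  (D <= maxn i j)%N ->
  `|pterm c x y i j| <= r ^- D * (`|x| ^+ D + `|y| ^+ D) * `|pterm c r r i j|.
Proof.
move=> r0 xr yr Dij.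
have pow_le (u : R) k : 0 <= u <= r -> u ^+ k <= r ^+ k.
  by move=> /andP[u0 ur]; rewrite lerXn2r ?nnegrE // ltW.
suff pow2_le : `|x| ^+ i * `|y| ^+ j <=
  r ^- D * (`|x| ^+ D + `|y| ^+ D) * (r ^+ i * r ^+ j).
  rewrite /pterm !normrM !normrX (gtr0_norm r0) -[leLHS]mulrA
    -[_ * r ^+ i * r ^+ j]mulrA.
  rewrite [leRHS]mulrCA.
  by rewrite ler_wpM2l.
have rVD0 : 0 <= r ^- D by rewrite invr_ge0 exprn_ge0 // ltW.
rewrite mulrDr mulrDl; move: Dij; rewrite leq_max => /orP[Di|Dj].
  apply: ler_wpDr; first by rewrite !mulr_ge0 ?exprn_ge0 // ltW.
  by rewrite mulrA ler_pM ?exprn_ge0 ?norm_expr_le_geom // pow_le ?normr_ge0.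
apply: ler_wpDl; first by rewrite !mulr_ge0 ?exprn_ge0 // ltW.
by rewrite mulrCA ler_pM ?exprn_ge0 ?norm_expr_le_geom // pow_le ?normr_ge0.
Qed.

Lemma reval_truncation_le c r D : 0 < r -> absconv c r -> exists2 K, 0 <= K &
  forall x y, `|x| <= r -> `|y| <= r ->
  `|reval c x y - sqsum (pterm c x y) D| <= K * (`|x| ^+ D + `|y| ^+ D).
Proof.
move=> r0 cr; have nr := gtr0_norm r0.
pose B := dsum (fun i j => `|pterm c r r i j|).
have B0 : 0 <= B.
  by apply: le_trans (sqsum_norm_le_dsum 0 cr); exact: sqsum_ge0.
exists (r ^- D * B) => [|x y xr yr];
  first by rewrite mulr_ge0 ?invr_ge0 ?exprn_ge0 // ltW.
pose A := r ^- D * (`|x| ^+ D + `|y| ^+ D).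
have A0 : 0 <= A by rewrite mulr_ge0 ?addr_ge0 ?invr_ge0 ?exprn_ge0 // ltW.
apply: le_trans (dsum_dist_le (g := fun i j => A * `|pterm c r r i j|) _ _ _) _.
- by move=> i j; exact: norm_pterm_high_le.
- by apply/dsummable_cvg/(pterm_dsummable cr); rewrite nr.
- by apply/cvg_ex; exists (A * B); exact: sqsumZ_cvg.
by rewrite dsumZ // mulrAC gerBl sqsum_ge0 // => i j; rewrite mulr_ge0.
Qed.

Lemma reval_bounded c r : 0 < r -> absconv c r -> exists2 K, 0 <= K &
  forall x y, `|x| <= r -> `|y| <= r -> `|reval c x y| <= K.
Proof.
move=> r0 cr; have [K K0 HK] := reval_truncation_le 0 r0 cr.
exists (K * 2) => [|x y xr yr]; first by rewrite mulr_ge0.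
by have := HK x y xr yr; rewrite /sqsum big_ord0 subr0 !expr0.
Qed.

Lemma norm_ge_half_monomial (a f tau t : R) (o : nat) : 0 <= tau <= t ->
  `|f - a * t ^+ o| <= `|a| * tau ^+ o / 2 -> `|a| * tau ^+ o / 2 <= `|f|.
Proof.
move=> /andP[tau0 tau_t] dist_le; set half := _ / 2 in dist_le *.
have main_ge : half + half <= `|a * t ^+ o|.
  rewrite -splitr normrM normrX (ger0_norm (le_trans tau0 tau_t)) ler_wpM2l //.
  by rewrite lerXn2r ?nnegrE // (le_trans tau0).
rewrite -[leLHS](addrK half); apply: le_trans (lerB main_ge dist_le) _.
by rewrite distrC; apply: le_trans (lerB_dist _ _) _; rewrite subKr.
Qed.

Lemma leading_monomial_lower_bound (F : R -> R -> R) (a A K r e : R) (o : nat) :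
  0 < r -> 0 < e -> a != 0 ->
  (forall x t, 0 <= x <= r -> 0 <= t <= r ->
    `|F x t - a * t ^+ o| <= A * x + K * t ^+ o.+1) ->
  exists tau gamma, [/\ 0 < tau, tau <= e, 0 < gamma & \forall x \near 0^'+,
    forall t, tau <= t <= 2 * tau -> gamma <= `|F x t|].
Proof.
move=> r0 e0 a0 expansion; have na0 : 0 < `|a| by rewrite normr_gt0.
pose K' := (`|K| + 1) * 2 ^+ o.+1.
have K'0 : 0 < K' by rewrite mulr_gt0 ?exprn_gt0 // ltr_wpDl.
near (0 : R)^'+ => tau.
have tau0 : 0 < tau by [].
have tau_r : tau <= r / 2 by near: tau; apply: nbhs_right_le; rewrite divr_gt0.
have tau_K : K' * tau <= `|a| / 4.
  by rewrite mulrC -ler_pdivlMr //; near: tau; apply: nbhs_right_le;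
    rewrite !divr_gt0.
pose gamma := `|a| * tau ^+ o / 2.
have gamma0 : 0 < gamma by rewrite divr_gt0 ?mulr_gt0 ?exprn_gt0.
exists tau, gamma; split=> //; first by near: tau; exact: nbhs_right_le.
near=> x => t /andP[tau_t t_tau].
have x0 : 0 < x by [].
have xr : x <= r by near: x; exact: nbhs_right_le.
have t0 : 0 < t by exact: lt_le_trans tau_t.
have x_term : A * x <= gamma / 2.
  apply: (@le_trans _ _ ((`|A| + 1) * x)).
    by rewrite ler_wpM2r ?(ltW x0) // ler_wpDr // ler_norm.
  rewrite mulrC -ler_pdivlMr ?ltr_wpDl //; near: x; apply: nbhs_right_le.
  by apply: divr_gt0; [rewrite divr_gt0|rewrite ltr_wpDl].
have t_term : K * t ^+ o.+1 <= gamma / 2.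
  apply: (@le_trans _ _ ((`|K| + 1) * (2 * tau) ^+ o.+1)).
    apply: (@le_trans _ _ ((`|K| + 1) * t ^+ o.+1)).
      by rewrite ler_wpM2r ?exprn_ge0 ?(ltW t0) // ler_wpDr // ler_norm.
    by rewrite ler_wpM2l ?addr_ge0 // lerXn2r ?nnegrE ?mulr_ge0 // ltW.
  have -> : (`|K| + 1) * (2 * tau) ^+ o.+1 = K' * tau * tau ^+ o.
    by rewrite exprMn [tau ^+ o.+1]exprS /K'; ring.
  have -> : gamma / 2 = `|a| / 4 * tau ^+ o by rewrite /gamma; field.
  by rewrite ler_wpM2r ?exprn_ge0 // ltW.
apply: (@norm_ge_half_monomial _ _ _ t); first by rewrite (ltW tau0).
rewrite -/gamma [gamma]splitr;
  apply: le_trans (expansion x t _ _) (lerD x_term t_term).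
  by rewrite (ltW x0).
by rewrite (ltW t0) (le_trans t_tau) // mulrC -ler_pdivlMr.
Unshelve. all: by end_near. Qed.

Lemma reval_row0_expansion c r o : 0 < r -> absconv c r ->
  (forall j, (j < o)%N -> c 0%N j = 0) ->
  exists A K, forall x y, 0 <= x <= Num.min 1 r -> 0 <= y <= Num.min 1 r ->
  `|reval c x y - c 0%N o * y ^+ o| <= A * x + K * y ^+ o.+1.
Proof.
move=> r0 cr c0; have [K K0 tail_le] := reval_truncation_le o.+1 r0 cr.
pose A := sqsum (fun i j => `|c i j|) o.+1.
exists (A + K), K => x y; rewrite !le_min => /and3P[x0 x1 xr] /and3P[y0 y1 yr].
have [nx ny] : `|x| = x /\ `|y| = y by rewrite !ger0_norm.
have head : `|sqsum (pterm c x y) o.+1 - c 0%N o * y ^+ o| <= A * x.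
  rewrite /A /sqsum big_ord_recl /= big_ord_recr /= big1 => [|j _]; last first.
    by rewrite /pterm c0 ?mul0r.
  rewrite add0r {1}/pterm expr0 mulr1 addrC addKr [in leRHS]big_ord_recl mulrDl.
  apply: ler_wpDl; first by rewrite mulr_ge0 ?sumr_ge0.
  rewrite mulr_suml; apply: le_trans (ler_norm_sum _ _ _) _;
    apply: ler_sum => i _.
  rewrite mulr_suml; apply: le_trans (ler_norm_sum _ _ _) _;
    apply: ler_sum => j _.
  rewrite /pterm !normrM !normrX nx ny -mulrA ler_wpM2l // -[leRHS]mulr1.
  by rewrite ler_pM ?exprn_ge0 ?exprn_ile1 // -[leRHS]expr1 ler_wiXn2l.
have tail : `|reval c x y - sqsum (pterm c x y) o.+1| <= K * x + K * y ^+ o.+1.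
  apply: le_trans (tail_le x y _ _) _;
    rewrite ?nx ?ny // mulrDr lerD2r ler_wpM2l //.
  by rewrite -[leRHS]expr1 ler_wiXn2l.
rewrite -(subrKA (sqsum (pterm c x y) o.+1)) mulrDl -[leRHS]addrA.
by apply: le_trans (ler_normD _ _) _; rewrite addrC lerD.
Qed.

Lemma reval_row0_lower_bound c r o e : 0 < r -> 0 < e -> absconv c r ->
  (forall j, (j < o)%N -> c 0%N j = 0) -> c 0%N o != 0 ->
  exists tau gamma, [/\ 0 < tau, tau <= e, 0 < gamma & \forall x \near 0^'+,
    forall t, tau <= t <= 2 * tau -> gamma <= `|reval c x t|].
Proof.
move=> r0 e0 cr c0 co; have [A [K expansion]] := reval_row0_expansion r0 cr c0.
have r'0 : 0 < Num.min 1 r by rewrite lt_min ltr01.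
exact: leading_monomial_lower_bound r'0 e0 co expansion.
Qed.

Definition row_shift k c (i j : nat) : R := c (i + k)%N j.

Lemma pterm_row_shift c k x y i j :
  x ^+ k * pterm (row_shift k c) x y i j = pterm c x y (i + k) j.
Proof. by rewrite /pterm /row_shift exprD; ring. Qed.

Section RowShift.
Variables (c : nat -> nat -> R) (k : nat) (r : R).
Hypotheses (r0 : 0 < r) (cr : absconv c r).
Hypothesis c0 : forall a b, (a < k)%N -> c a b = 0.

Let pterm0 x y i j : (i < k)%N -> pterm c x y i j = 0.
Proof. by move=> ik; rewrite /pterm c0 ?mul0r. Qed.

Lemma absconv_row_shift : absconv (row_shift k c) r.
Proof.
pose B := dsum (fun i j => `|pterm c r r i j|).
apply: (@dsummable_bound _ _ (r ^- k * B)) => N.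
have rk0 : 0 < r ^+ k by rewrite exprn_gt0.
rewrite mulrC ler_pdivlMr // mulrC -sqsumZ.
apply: le_trans (sqsum_norm_le_dsum (N + k) cr).
rewrite [leRHS](sqsum_row_shift (k := k)) => [|i j ik];
  last by rewrite pterm0 ?normr0.
apply: (@le_trans _ _ (sqsum (fun i j =>
    if (i + k < N + k)%N then `|pterm c r r (i + k) j| else 0) N)).
  apply: ler_sum => i _; apply: ler_sum => j _; rewrite ltn_add2r ltn_ord.
  by rewrite -(pterm_row_shift c k) [in leRHS]normrM (gtr0_norm rk0).
by apply: nondecreasing_sqsum => [i j|]; [case: ifP|exact: leq_addr].
Qed.

Lemma reval_row_shift x y : `|x| <= r -> `|y| <= r ->
  reval c x y = x ^+ k * reval (row_shift k c) x y.
Proof.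
move=> xr yr.
have sumG : dsummable (pterm (row_shift k c) x y).
  by apply: (pterm_dsummable absconv_row_shift); rewrite (gtr0_norm r0).
rewrite -dsumZ; last exact: dsummable_cvg.
apply/cvg_lim => //.
rewrite [X in X @ _](_ : _ = fun n => sqsum
    (fun i j => if (i + k < n)%N then pterm c x y (i + k) j else 0) n);
  last first.
  by apply/funext => n; apply: sqsum_row_shift => i j; exact: pterm0.
apply: (sqsum_dominated_cvg (phi := id) (dsummableZ (a := x ^+ k) sumG)) => //.
  by move=> n i j; rewrite pterm_row_shift; case: ifP => // _; rewrite normr0.
move=> i j; rewrite pterm_row_shift; apply: cvg_near_cst.
by exists (i + k).+1 => // n /= ->.
Qed.

End RowShift.

Lemma reval_lower_bound c r a b e :
  0 < r -> 0 < e -> absconv c r -> c a b != 0 ->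
  exists tau gamma, [/\ 0 < tau, tau <= e, 0 < gamma & \forall x \near 0^'+,
    forall t, tau <= t <= 2 * tau -> gamma * x ^+ a <= `|reval c x t|].
Proof.
move=> r0 e0 cr cab; pose nonzero_row K := `[< exists b, c K b != 0 >].
have exK : exists K, nonzero_row K by exists a; apply/asboolP; exists b.
case: (ex_minnP exK) => K /asboolP exb Kmin.
case: (ex_minnP exb) => o cKo omin.
have c0 i j : (i < K)%N -> c i j = 0.
  move=> iK; apply/eqP; apply: contraTT iK => cij.
  by rewrite -leqNgt Kmin //; apply/asboolP; exists j.
have cK0 j : (j < o)%N -> row_shift K c 0 j = 0.
  by move=> jo; apply/eqP; apply: contraTT jo => /omin; rewrite leqNgt.
have e'0 : 0 < Num.min e (r / 2) by rewrite lt_min e0 divr_gt0.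
have [tau [gamma [tau0 taue gamma0 low]]] :=
  reval_row0_lower_bound r0 e'0 (absconv_row_shift r0 cr c0) cK0 cKo.
move: taue; rewrite le_min => /andP[taue taur].
exists tau, gamma; split=> //; near=> x => t /andP[tau_t t_tau].
have x0 : 0 < x by [].
have nx : `|x| = x by exact: gtr0_norm.
rewrite (reval_row_shift r0 cr c0) ?normrM ?normrX ?nx.
- rewrite mulrC ler_pM ?exprn_ge0 ?(ltW gamma0) ?(ltW x0) //.
    rewrite ler_wiXn2l ?(ltW x0) ?Kmin //;
      first by near: x; exact: nbhs_right_le.
    by apply/asboolP; exists b.
  have low_x : forall t, tau <= t <= 2 * tau ->
    gamma <= `|reval (row_shift K c) x t|.
    by near: x.
  by apply: low_x; rewrite tau_t.
- by near: x; exact: nbhs_right_le.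
rewrite ger0_norm ?(le_trans (ltW tau0)) //; lra.
Unshelve. all: by end_near. Qed.

Definition box (e : R) : set (R * R) := [set z | `|z.1| < e /\ `|z.2| < e].

Lemma near0_boxP (P : set (R * R)) :
  (\forall z \near (0 : R * R), P z) <-> exists2 e, 0 < e & box e `<=` P.
Proof.
split=> [/nbhs_ballP[e /= e0 eP]|[e e0 eP]].
  exists e => // z [z1 z2]; apply: eP; split; rewrite /ball /= sub0r normrN //.
apply/nbhs_ballP; exists e => //= z [/=];
  rewrite /ball /= !sub0r !normrN => z1 z2.
exact: eP.
Qed.

Lemma coef_eq0_of_bound c r k K a b : 0 < r -> absconv c r ->
  (\forall z \near (0 : R * R), `|reval c z.1 z.2| <= K * `|z.1| ^+ k) ->
  (a < k)%N -> c a b = 0.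
Proof.
move=> r0 cr /near0_boxP[e e0 bound] ak; apply/eqP/negP => /negP cab.
have e3 : 0 < e / 3 by rewrite divr_gt0.
have [tau [gamma [tau0 taue gamma0 low]]] := reval_lower_bound r0 e3 cr cab.
near (0 : R)^'+ => x.
have x0 : 0 < x by [].
have nx : `|x| = x by exact: gtr0_norm.
have low_x : gamma * x ^+ a <= `|reval c x tau|.
  have : forall t, tau <= t <= 2 * tau -> gamma * x ^+ a <= `|reval c x t|
    by near: x.
  by apply; rewrite lexx; lra.
have up_x : `|reval c x tau| <= `|K| * x * x ^+ a.
  apply: le_trans (bound (x, tau) _) _; rewrite /= ?nx.
    by split; rewrite /= ?nx ?(gtr0_norm tau0);
      [near: x; exact: nbhs_right_lt|lra].
  apply: le_trans (_ : `|K| * x ^+ k <= _).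
    by rewrite ler_wpM2r ?exprn_ge0 ?(ltW x0) // ler_norm.
  rewrite -mulrA -exprS ler_wpM2l // ler_wiXn2l ?(ltW x0) //.
  by near: x; exact: nbhs_right_le.
have : gamma <= `|K| * x.
  by rewrite -(ler_pM2r (exprn_gt0 a x0)); exact: le_trans low_x up_x.
have : (`|K| + 1) * x < gamma.
  rewrite mulrC -ltr_pdivlMr ?ltr_wpDl //.
  by near: x; apply: nbhs_right_lt; rewrite divr_gt0 // ltr_wpDl.
lra.
Unshelve. all: by end_near. Qed.

End PowerSeries.

(** * Substitution of polynomials in a power series *)

Section FormalSubstitution.
Variable R : comNzRingType.
Implicit Types (c : nat -> nat -> R) (P S T : {poly {poly R}}) (q : {poly R}).

Definition order_ge (d : nat) P := forall a b, (a + b < d)%N -> P`_b`_a = 0.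

Lemma order_geM d e P S : order_ge d P -> order_ge e S ->
  order_ge (d + e) (P * S).
Proof.
move=> oP oS a b ab; rewrite coefM coef_sum big1 // => i _;
  rewrite coefM big1 // => k _.
have [di|id] := ltnP (k + i) d; first by rewrite oP ?mul0r.
by rewrite oS ?mulr0 //; have := ltn_ord i; have := ltn_ord k; lia.
Qed.

Lemma order_geXn P k : P`_0`_0 = 0 -> order_ge k (P ^+ k).
Proof.
move=> P0; elim: k => [|k IH] //; rewrite exprS -add1n;
  apply: order_geM => // a b.
by rewrite ltnS leqn0 addn_eq0 => /andP[/eqP -> /eqP ->].
Qed.

(* The coefficients of [sum_(i, j) c i j * E i j]; when [E i j] has order at
   least [i + j], the terms left out of the sum below vanish. *)
Definition recombine c (E : nat -> nat -> {poly {poly R}}) (a b : nat) : R :=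
  sqsum (fun i j => c i j * (E i j)`_b`_a) (a + b).+1.

Lemma recombine_wide c E a b N : (forall i j, order_ge (i + j) (E i j)) ->
  (a + b < N)%N ->
  recombine c E a b = sqsum (fun i j => c i j * (E i j)`_b`_a) N.
Proof.
move=> ordE abN; rewrite [RHS](@sqsum_stable _ _ (a + b).+1) // => i j.
by rewrite leq_max => ij; rewrite ordE ?mulr0 //; lia.
Qed.

Definition comp_series c S T := recombine c (fun i j => S ^+ i * T ^+ j).

Lemma monomial_order S T : S`_0`_0 = 0 -> T`_0`_0 = 0 ->
  forall i j, order_ge (i + j) (S ^+ i * T ^+ j).
Proof. by move=> S0 T0 i j; apply: order_geM; exact: order_geXn. Qed.

Definition branch_series q c := comp_series c 'X%:P ('X - q%:P).

Definition blowup_series n q c := comp_series c 'X%:P (('X^n)%:P * 'X - q%:P).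

Lemma coef00_polyX : ('X%:P : {poly {poly R}})`_0`_0 = 0.
Proof. by rewrite coefC coefX. Qed.

Lemma coef00_translate q : q`_0 = 0 -> ('X - q%:P)`_0`_0 = 0.
Proof. by move=> q0; rewrite coefB coefX coefC sub0r coefN q0 oppr0. Qed.

Lemma branch_monomial_order q : q`_0 = 0 ->
  forall i j, order_ge (i + j) ('X%:P ^+ i * ('X - q%:P) ^+ j).
Proof.
by move=> /coef00_translate; apply: monomial_order; exact: coef00_polyX.
Qed.

Lemma coef00_blowup n q : q`_0 = 0 -> (('X^n)%:P * 'X - q%:P)`_0`_0 = 0.
Proof.
by move=> q0; rewrite coefB coefCM coefX mulr0 coefC sub0r coefN q0 oppr0.
Qed.

Lemma blowup_monomialE n q i j : 'X%:P ^+ i * (('X^n)%:P * 'X - q%:P) ^+ j =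
  weight_subst n ('X%:P ^+ i * ('X - q%:P) ^+ j).
Proof.
by rewrite /weight_subst rmorphM !rmorphXn rmorphB /= !comp_polyC comp_polyX.
Qed.

Lemma blowup_series_coef n q c a b : q`_0 = 0 ->
  blowup_series n q c (a + n * b) b = branch_series q c a b.
Proof.
move=> /branch_monomial_order ord; rewrite /branch_series /comp_series.
rewrite (recombine_wide (N := (a + n * b + b).+1) _ ord); last by lia.
apply: eq_sqsum => i j.
by rewrite blowup_monomialE coef_weight_subst coefMXn ltnNge leq_addl addnK.
Qed.

Definition trunc D c : {poly {poly R}} :=
  \sum_(i < D) \sum_(j < D) (c i j)%:P%:P * ('X%:P ^+ i * 'X ^+ j).

Lemma coef_trunc_branch D q c a b : q`_0 = 0 -> (a + b < D)%N ->
  (trunc D c \Po ('X - q%:P))`_b`_a = branch_series q c a b.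
Proof.
move=> /branch_monomial_order ord abD.
rewrite /branch_series /comp_series (recombine_wide _ ord abD).
rewrite /trunc rmorph_sum !coef_sum; apply: eq_bigr => i _.
rewrite rmorph_sum !coef_sum; apply: eq_bigr => j _.
by rewrite !rmorphM !rmorphXn /= !comp_polyC comp_polyX !coefCM.
Qed.

End FormalSubstitution.

Section CoefficientMajorants.
Variable R : numDomainType.
Implicit Types P S : {poly {poly R}}.

Definition coef_norm_le P S := forall a b, `|P`_b`_a| <= S`_b`_a.

Definition norm_poly2 P : {poly {poly R}} := map_poly (map_poly Num.norm) P.

Lemma coef_norm_poly2 P a b : (norm_poly2 P)`_b`_a = `|P`_b`_a|.
Proof. by rewrite !coef_map_id0 ?map_poly0 ?normr0. Qed.

Lemma coef_norm_le_norm_poly2 P : coef_norm_le P (norm_poly2 P).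
Proof. by move=> a b; rewrite coef_norm_poly2. Qed.

Lemma coef_norm_le1 : coef_norm_le 1 1.
Proof.
by move=> a b; rewrite coef1; case: eqP => _;
  rewrite ?coef1 ?coef0 ?normr_nat ?normr0.
Qed.

Lemma coef_norm_leM P S P' S' :
  coef_norm_le P S -> coef_norm_le P' S' -> coef_norm_le (P * P') (S * S').
Proof.
move=> PS PS' a b; rewrite !coefM !coef_sum (le_trans (ler_norm_sum _ _ _)) //.
apply: ler_sum => i _; rewrite !coefM (le_trans (ler_norm_sum _ _ _)) //.
by apply: ler_sum => k _; rewrite normrM ler_pM.
Qed.

Lemma coef_norm_leXn P S k : coef_norm_le P S -> coef_norm_le (P ^+ k) (S ^+ k).
Proof.
move=> PS; elim: k => [|k IH]; first by rewrite !expr0; exact: coef_norm_le1.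
by rewrite !exprS; apply: coef_norm_leM.
Qed.

End CoefficientMajorants.

Section Evaluation.
Variable R : comNzRingType.
Implicit Types (P S : {poly {poly R}}) (x y : R).

Definition ev P x y : R := P.[y%:P].[x].

Lemma evM P S x y : ev (P * S) x y = ev P x y * ev S x y.
Proof. by rewrite /ev !hornerM. Qed.

Lemma evXn P k x y : ev (P ^+ k) x y = ev P x y ^+ k.
Proof. by rewrite /ev !horner_exp. Qed.

Lemma evB P S x y : ev (P - S) x y = ev P x y - ev S x y.
Proof. by rewrite /ev !hornerD !hornerN. Qed.

Lemma evC (p : {poly R}) x y : ev p%:P x y = p.[x].
Proof. by rewrite /ev hornerC. Qed.

Lemma evX x y : ev 'X x y = y.
Proof. by rewrite /ev hornerX hornerC. Qed.

Lemma ev_diag P x : ev P x x = P.['X].[x].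
Proof.
rewrite /ev !(horner_coef P) !horner_sum; apply: eq_bigr => b _.
by rewrite !hornerM !horner_exp hornerC hornerX.
Qed.

End Evaluation.

Section PolynomialSeries.
Variable R : realType.
Implicit Types (P S : {poly {poly R}}) (x y r : R).

Lemma ev_diag_cvg0 P : P`_0`_0 = 0 -> ev P x x @[x --> 0] --> (0 : R).
Proof.
move=> P0; under eq_cvg do rewrite ev_diag.
have := @continuous_horner _ P.['X] (0 : R).
by rewrite /continuous_at -ev_diag /ev !horner_coef0 P0.
Qed.

Definition coef2 P (a b : nat) : R := P`_b`_a.

Lemma sqsum_pterm_poly P :
  \forall N \near \oo, forall x y, sqsum (pterm (coef2 P) x y) N = ev P x y.
Proof.
exists (maxn (size P) (\max_(b < size P) size (P`_b)%R)) => // N /=.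
rewrite geq_max => /andP[PN PbN] x y.
rewrite /ev /sqsum (horner_coef_wide _ PN) horner_sum exchange_big /=.
apply: eq_bigr => b _; rewrite hornerM horner_exp hornerC.
have sizePb : (size (P`_b)%R <= N)%N.
  have [bP|Pb] := ltnP b (size P); last by rewrite nth_default // size_poly0.
  exact: leq_trans (leq_bigmax (Ordinal bP)) PbN.
by rewrite (horner_coef_wide _ sizePb) mulr_suml.
Qed.

Lemma sqsum_norm_pterm_le P S r x y N :
  coef_norm_le P S -> 0 <= r -> `|x| <= r -> `|y| <= r ->
  sqsum (fun a b => `|pterm (coef2 P) x y a b|) N <= ev S r r.
Proof.
move=> PS r0 xr yr.
have S0 a b : 0 <= coef2 S a b := le_trans (normr_ge0 _) (PS a b).
near \oo => N'.
have <- : sqsum (pterm (coef2 S) r r) N' = ev S r r.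
  have : forall x y, sqsum (pterm (coef2 S) x y) N' = ev S x y; last by apply.
  by near: N'; exact: sqsum_pterm_poly.
apply: (@le_trans _ _ (sqsum (pterm (coef2 S) r r) N)).
  apply: ler_sqsum => a b; rewrite /pterm !normrM !normrX.
  by rewrite !ler_pM ?mulr_ge0 ?exprn_ge0 ?PS // lerXn2r ?nnegrE.
apply: nondecreasing_sqsum => [a b|];
  first by rewrite /pterm !mulr_ge0 ?exprn_ge0.
by near: N'; exact: nbhs_infty_ge.
Unshelve. all: by end_near. Qed.

Lemma norm_ev_le P S r x y :
  coef_norm_le P S -> 0 <= r -> `|x| <= r -> `|y| <= r ->
  `|ev P x y| <= ev S r r.
Proof.
move=> PS r0 xr yr; near \oo => N.
have <- : sqsum (pterm (coef2 P) x y) N = ev P x y.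
  have : forall x y, sqsum (pterm (coef2 P) x y) N = ev P x y; last by apply.
  by near: N; exact: sqsum_pterm_poly.
exact: le_trans (ler_norm_sqsum _ _) (sqsum_norm_pterm_le _ PS r0 xr yr).
Unshelve. all: by end_near. Qed.

End PolynomialSeries.

Section Recombination.
Variable R : realType.
Variables (c : nat -> nat -> R) (E Eb : nat -> nat -> {poly {poly R}}) (r : R).
Hypothesis r0 : 0 <= r.
Hypothesis ordE : forall i j, order_ge (i + j) (E i j).
Hypothesis EEb : forall i j, coef_norm_le (E i j) (Eb i j).
Hypothesis sumEb : dsummable (fun i j => c i j * ev (Eb i j) r r).

Let evEb_ge0 i j : 0 <= ev (Eb i j) r r.
Proof.
by apply: le_trans (norm_ev_le (x := 0) (y := 0) (EEb i j) r0 _ _);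
  rewrite ?normr0.
Qed.

Lemma sqsum_pterm_recombine x y N : sqsum (pterm (recombine c E) x y) N =
  sqsum (fun i j => c i j * sqsum (pterm (coef2 (E i j)) x y) N) (2 * N).
Proof.
under [RHS]eq_sqsum => i j do rewrite -sqsumZ.
rewrite -sqsum_exchange; apply: eq_bigr => a _; apply: eq_bigr => b _.
rewrite /pterm (recombine_wide (N := 2 * N) _ ordE); last first.
  by have := ltn_ord a; have := ltn_ord b; lia.
rewrite -mulrA mulrC -sqsumZ; apply: eq_sqsum => i j; rewrite /coef2; ring.
Qed.

Lemma absconv_recombine : absconv (recombine c E) r.
Proof.
pose B := dsum (fun i j => `|c i j * ev (Eb i j) r r|).
apply: (@dsummable_bound _ _ B) => N.
apply: le_trans (sqsum_norm_le_dsum (2 * N) sumEb).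
apply: (@le_trans _ _ (sqsum (fun i j =>
    `|c i j| * sqsum (fun a b => `|pterm (coef2 (E i j)) r r a b|) N) (2 * N))).
  under [leRHS]eq_sqsum => i j do rewrite -sqsumZ.
  rewrite -sqsum_exchange; apply: ler_sum => a _; apply: ler_sum => b _.
  rewrite /pterm (recombine_wide (N := 2 * N) _ ordE); last first.
    by have := ltn_ord a; have := ltn_ord b; lia.
  rewrite -mulrA mulrC -sqsumZ; apply: le_trans (ler_norm_sqsum _ _) _.
  apply: ler_sqsum => i j; rewrite -normrM /coef2 le_eqVlt; apply/orP; left;
    apply/eqP.
  by congr `|_|; ring.
apply: ler_sqsum => i j; rewrite normrM (ger0_norm (evEb_ge0 i j)) ler_wpM2l //.
by apply: sqsum_norm_pterm_le; rewrite // ger0_norm.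
Qed.

Lemma reval_recombine x y : `|x| <= r -> `|y| <= r ->
  reval (recombine c E) x y = dsum (fun i j => c i j * ev (E i j) x y).
Proof.
move=> xr yr; apply/cvg_lim => //.
under eq_cvg => N do rewrite sqsum_pterm_recombine.
apply: (sqsum_dominated_cvg (phi := muln 2) sumEb).
- move=> N i j; rewrite !normrM (ger0_norm (evEb_ge0 i j)) ler_wpM2l //.
  exact: le_trans (ler_norm_sqsum _ _)
    (sqsum_norm_pterm_le _ (EEb i j) r0 xr yr).
- move=> i j; apply: cvgMl_tmp; apply: cvg_near_cst.
  by apply: filterS (sqsum_pterm_poly (E i j)) => N.
- by move=> N; rewrite leq_pmull.
Qed.

End Recombination.

Section Composition.
Variable R : realType.
Implicit Types (c : nat -> nat -> R) (S T : {poly {poly R}}) (q : {poly R})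
  (r : R).

Lemma comp_series_eval c S T r :
  0 < r -> absconv c r -> S`_0`_0 = 0 -> T`_0`_0 = 0 ->
  exists s, [/\ 0 < s, absconv (comp_series c S T) s &
    forall x y, `|x| <= s -> `|y| <= s ->
    reval (comp_series c S T) x y = reval c (ev S x y) (ev T x y)].
Proof.
move=> r0 cr S0 T0.
have small (P : {poly {poly R}}) : P`_0`_0 = 0 ->
  \forall s \near (0 : R)^'+, `|ev (norm_poly2 P) s s| <= r.
  move=> P0; apply: cvgr0_norm_le r0; apply: cvg_at_right_filter.
  by apply: ev_diag_cvg0; rewrite coef_norm_poly2 P0 normr0.
near (0 : R)^'+ => s.
have s0 : 0 < s by [].
have Ss : `|ev (norm_poly2 S) s s| <= `|r|
  by rewrite (gtr0_norm r0); near: s; exact: small.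
have Ts : `|ev (norm_poly2 T) s s| <= `|r|
  by rewrite (gtr0_norm r0); near: s; exact: small.
have dom i j :
    coef_norm_le (S ^+ i * T ^+ j) (norm_poly2 S ^+ i * norm_poly2 T ^+ j).
  by apply: coef_norm_leM; apply: coef_norm_leXn;
    exact: coef_norm_le_norm_poly2.
have ordE := monomial_order S0 T0.
have sumEb : dsummable
  (fun i j => c i j * ev (norm_poly2 S ^+ i * norm_poly2 T ^+ j) s s).
  by under eq2_fun do rewrite evM !evXn mulrA; exact: pterm_dsummable cr Ss Ts.
exists s; split=> //; first exact: absconv_recombine (ltW s0) ordE dom sumEb.
move=> x y xs ys; rewrite (reval_recombine (ltW s0) ordE dom sumEb) //.
by congr dsum; apply/funext => i; apply/funext => j; rewrite evM !evXn mulrA.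
Unshelve. all: by end_near. Qed.

Lemma branch_series_eval q c r : 0 < r -> absconv c r -> q`_0 = 0 ->
  exists s, [/\ 0 < s, absconv (branch_series q c) s &
    forall x y, `|x| <= s -> `|y| <= s ->
    reval (branch_series q c) x y = reval c x (y - q.[x])].
Proof.
move=> r0 cr q0.
have [s [s0 cs evs]] :=
  comp_series_eval r0 cr (coef00_polyX R) (coef00_translate q0).
by exists s; split=> // x y xs ys; rewrite evs // evB !evC evX hornerX.
Qed.

Lemma blowup_series_eval n q c r : 0 < r -> absconv c r -> q`_0 = 0 ->
  exists s, [/\ 0 < s, absconv (blowup_series n q c) s &
    forall x y, `|x| <= s -> `|y| <= s ->
    reval (blowup_series n q c) x y = reval c x (x ^+ n * y - q.[x])].
Proof.
move=> r0 cr q0.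
have [s [s0 cs evs]] :=
  comp_series_eval r0 cr (coef00_polyX R) (coef00_blowup n q0).
by exists s; split=> // x y xs ys;
  rewrite evs // evB evM !evC evX hornerX hornerXn.
Qed.

End Composition.

(** * Size of the denominator *)

Section PolynomialsNear0.
Variable R : realType.
Implicit Types g : {poly R}.

Lemma horner_le_Xn g m : (forall a, (a < m)%N -> g`_a = 0) ->
  exists2 C, 0 < C & forall x, `|x| <= 1 -> `|g.[x]| <= C * `|x| ^+ m.
Proof.
move=> g0; exists (1 + \sum_(a < size g) `|g`_a|);
  first by rewrite ltr_wpDr // sumr_ge0.
move=> x x1; rewrite horner_coef mulrDl mul1r
  (le_trans (ler_norm_sum _ _ _)) //.
apply: ler_wpDl; first exact: exprn_ge0.
rewrite mulr_suml; apply: ler_sum => a _; rewrite normrM normrX.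
have [am|ma] := ltnP a m; first by rewrite g0 // normr0 !mul0r.
by rewrite ler_wpM2l // ler_wiXn2l.
Qed.

Lemma horner_ge_Xn g m : (forall a, (a < m)%N -> g`_a = 0) -> g`_m != 0 ->
  exists2 C, 0 < C & \forall x \near (0 : R), C * `|x| ^+ m <= `|g.[x]|.
Proof.
move=> g0 gm; have gm2 : 0 < `|g`_m| / 2 by rewrite divr_gt0 ?normr_gt0.
exists (`|g`_m| / 2) => //; near=> x.
rewrite -[in leRHS](drop_polyK_low g0) hornerM hornerXn normrM normrX ler_wpM2r
  ?exprn_ge0 //.
near: x; apply: (@cvgr_norm_ge _ _ _ _ _ _ (drop_poly m g).[0]);
  first exact: continuous_horner.
rewrite horner_coef0 coef_drop_poly add0n; lra.
Unshelve. all: by end_near. Qed.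

Definition height g (z : R * R) : R := z.2 + g.[z.1].

Lemma continuous_height g : continuous (height g).
Proof.
move=> z; apply: cvgD; first exact: cvg_snd.
by apply: (continuous_comp (f := fst));
  [exact: cvg_fst|exact: continuous_horner].
Qed.

Lemma near0_fst (P : set R) :
  (\forall x \near (0 : R), P x) -> \forall z \near (0 : R * R), P z.1.
Proof.
have fst_cvg : fst @ (0 : R * R) --> (0 : R) by exact: cvg_fst.
exact: fst_cvg.
Qed.

Lemma near0_height g e :
  g`_0 = 0 -> 0 < e -> \forall z \near (0 : R * R), `|height g z| < e.
Proof.
move=> g0 e0.
have height0 : height g 0 = 0 by rewrite /height horner_coef0 g0 addr0.
have := @continuous_height g 0.
by rewrite /continuous_at height0 => /cvgr0_norm_lt; apply.
Qed.

End PolynomialsNear0.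

Section ComplexModulus.
Variable R : realType.
Implicit Types z w : R[i].

Lemma cmodE z : cmod z = ComplexField.Normc.normc z.
Proof. by case: z. Qed.

Lemma cmod_ge0 z : 0 <= cmod z.
Proof. exact: sqrtr_ge0. Qed.

Lemma Re_le_cmod z : `|complex.Re z| <= cmod z.
Proof. by rewrite -sqrtr_sqr ler_sqrt ?addr_ge0 ?sqr_ge0 // lerDl sqr_ge0. Qed.

Lemma Im_le_cmod z : `|complex.Im z| <= cmod z.
Proof. by rewrite -sqrtr_sqr ler_sqrt ?addr_ge0 ?sqr_ge0 // lerDr sqr_ge0. Qed.

Lemma cmod_le z : cmod z <= `|complex.Re z| + `|complex.Im z|.
Proof.
rewrite -[leRHS]ger0_norm ?addr_ge0 // -sqrtr_sqr ler_sqrt ?sqr_ge0 //.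
by rewrite sqrrD !real_normK ?num_real // addrAC lerDl mulrn_wge0 // mulr_ge0.
Qed.

Lemma cmod_prod (I : Type) (s : seq I) (F : I -> R[i]) :
  cmod (\prod_(i <- s) F i) = \prod_(i <- s) cmod (F i).
Proof.
elim: s => [|i s IH]; first by rewrite !big_nil cmodE ComplexField.Normc.normc1.
by rewrite !big_cons cmodE ComplexField.Normc.normcM -!cmodE IH.
Qed.

Lemma cmod_div z w : cmod (z / w) = cmod z / cmod w.
Proof.
by rewrite cmodE ComplexField.Normc.normcM ComplexField.Normc.normcV -!cmodE.
Qed.

End ComplexModulus.

Lemma coef_ordp (R : realType) (g : {poly R}) : g != 0 -> g`_(ordp g) != 0.
Proof.
move=> g0; apply: (nth_find 0 (a := fun a => a != 0)); apply/(has_nthP 0).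
exists (size g).-1; first by rewrite prednK // size_poly_gt0.
by rewrite -lead_coefE lead_coef_eq0.
Qed.

Lemma leq_ordp (R : realType) (g : {poly R}) m : g != 0 ->
  (m <= ordp g)%N <-> forall a, (a < m)%N -> g`_a = 0.
Proof.
move=> g0; split=> [le_m a am|low0].
  by have := before_find 0 (leq_trans am le_m) => /negbFE /eqP.
by rewrite leqNgt; apply/negP => /low0; apply/eqP/coef_ordp.
Qed.

Section Denominator.
Variables (R : realType) (M : nat) (L : 'I_M -> nat) (q : 'I_M -> {poly R}).
Implicit Types (i j : 'I_M) (z : R * R).

Lemma leq_Oij i j m : (m <= Oij L q i j)%N <->
  [/\ (m <= 2 * L j)%N, (m <= 2 * L i)%N
    & forall a, (a < m)%N -> (q j)`_a = (q i)`_a].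
Proof.
rewrite /Oij; case: eqP => [/eqP|/eqP nz].
  by rewrite subr_eq0 => /eqP ->; rewrite leq_min; split=> [/andP[]|[-> ->]].
rewrite !leq_min; split=> [/and3P[/(leq_ordp _ nz) low0 ? ?]|[-> -> qij]].
  by split=> // a /low0 /eqP; rewrite coefB subr_eq0 => /eqP.
rewrite !andbT; apply/(leq_ordp _ nz) => a /qij.
by rewrite coefB => ->; rewrite subrr.
Qed.

Lemma Oij_le_l i j : (Oij L q i j <= 2 * L i)%N.
Proof. by have [] := (leq_Oij i j _).1 (leqnn _). Qed.

Lemma Oij_le_r i j : (Oij L q i j <= 2 * L j)%N.
Proof. by have [] := (leq_Oij i j _).1 (leqnn _). Qed.

Lemma Oij_coef i j a : (a < Oij L q i j)%N -> (q j)`_a = (q i)`_a.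
Proof. by have [_ _] := (leq_Oij i j _).1 (leqnn _); apply. Qed.

Definition factor j z : R[i] := (height (q j) z +i* z.1 ^+ (2 * L j))%C.

Lemma cmod_Pval z : cmod (Pval L q z.1 z.2) = \prod_(i < M) cmod (factor i z).
Proof. exact: cmod_prod. Qed.

Lemma height_le_factor j z : `|height (q j) z| <= cmod (factor j z).
Proof. exact: (Re_le_cmod (factor j z)). Qed.

Lemma Xn_le_factor j z : `|z.1| ^+ (2 * L j) <= cmod (factor j z).
Proof. by rewrite -normrX; exact: (Im_le_cmod (factor j z)). Qed.

Lemma factor_upper_bound i j :
  exists2 C, 0 < C & forall x t, `|x| <= 1 -> `|t| <= 1 ->
  cmod (factor i (x, x ^+ (2 * L j) * t - (q j).[x])) <=
    C * `|x| ^+ Oij L q i j.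
Proof.
have [C C0 diff_le] : exists2 C, 0 < C &
    forall x, `|x| <= 1 -> `|(q i - q j).[x]| <= C * `|x| ^+ Oij L q i j.
  by apply: horner_le_Xn => a /Oij_coef; rewrite coefB => ->; rewrite subrr.
exists (2 + C) => [|x t x1 t1]; first by lra.
apply: le_trans (cmod_le _) _; rewrite /= /height /= normrX.
have xi : `|x| ^+ (2 * L i) <= `|x| ^+ Oij L q i j
  by rewrite ler_wiXn2l ?Oij_le_l.
have xj : `|x ^+ (2 * L j) * t| <= `|x| ^+ Oij L q i j.
  rewrite normrM normrX -[leRHS]mulr1 ler_pM ?exprn_ge0 //.
  by rewrite ler_wiXn2l ?Oij_le_r.
have height_le : `|x ^+ (2 * L j) * t - (q j).[x] + (q i).[x]| <=
    `|x ^+ (2 * L j) * t| + `|(q i - q j).[x]|.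
  by rewrite -addrA (addrC (- _)) hornerD hornerN ler_normD.
have := diff_le x x1; lra.
Qed.

Lemma Pval_upper_bound j :
  exists2 C, 0 < C & forall x t, `|x| <= 1 -> `|t| <= 1 ->
  cmod (Pval L q x (x ^+ (2 * L j) * t - (q j).[x])) <=
    C * `|x| ^+ (\sum_(i < M) Oij L q i j).
Proof.
have /choice[C CP] : forall i, exists C,
    0 < C /\ forall x t, `|x| <= 1 -> `|t| <= 1 ->
    cmod (factor i (x, x ^+ (2 * L j) * t - (q j).[x])) <=
      C * `|x| ^+ Oij L q i j.
  by move=> i; have [C C0 HC] := factor_upper_bound i j; exists C.
exists (\prod_i C i) => [|x t x1 t1];
  first by apply: prodr_gt0 => i _; have [] := CP i.
rewrite (cmod_Pval (x, _)) -prodrXr -big_split; apply: ler_prod => i _.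
by rewrite cmod_ge0; have [_ ->] := CP i.
Qed.

Lemma factor_lower_bound i j : exists2 C, 0 < C <= 1 &
  \forall z \near (0 : R * R),
  cmod (factor j z) <= cmod (factor i z) ->
    C * `|z.1| ^+ Oij L q i j <= cmod (factor i z).
Proof.
have [oE|oE] := eqVneq (Oij L q i j) (2 * L j)%N.
  exists 1; rewrite ?ltr01 //=; near=> z => le_ji.
  by rewrite mul1r oE; exact: le_trans (Xn_le_factor j z) le_ji.
have [oE'|oE'] := eqVneq (Oij L q i j) (2 * L i)%N.
  exists 1; rewrite ?ltr01 //=; near=> z => _.
  by rewrite mul1r oE'; exact: Xn_le_factor.
have [||C C0 diff_ge] := @horner_ge_Xn R (q j - q i) (Oij L q i j).
- by move=> a /Oij_coef; rewrite coefB => ->; rewrite subrr.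
- apply/eqP => coefO; suff : (Oij L q i j < Oij L q i j)%N by rewrite ltnn.
  apply/leq_Oij; rewrite !ltn_neqAle oE oE' Oij_le_l Oij_le_r; split=> // a.
  rewrite ltnS leq_eqVlt => /predU1P[->|/Oij_coef //].
  by apply/eqP; rewrite -subr_eq0 -coefB coefO.
exists (Num.min 1 (C / 2));
  first by rewrite lt_min ltr01 divr_gt0 // ge_min lexx.
near=> z => le_ji.
have diff_ge_z : C * `|z.1| ^+ Oij L q i j <= `|(q j - q i).[z.1]|
  by near: z; exact: near0_fst diff_ge.
have diff_le : `|(q j - q i).[z.1]| <= `|height (q j) z| + `|height (q i) z|.
  have -> : (q j - q i).[z.1] = height (q j) z - height (q i) z.
    by rewrite /height hornerD hornerN; lra.
  exact: ler_normB.
apply: (@le_trans _ _ (C / 2 * `|z.1| ^+ Oij L q i j)).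
  by rewrite ler_wpM2r ?exprn_ge0 // ge_min lexx orbT.
have := height_le_factor j z; have := height_le_factor i z; lra.
Unshelve. all: by end_near. Qed.

End Denominator.

(** * Bounds near the closest branch *)

Lemma min_natr_interpolation (R : realFieldType) (o m : nat) (s : R) :
  0 <= s <= 1 ->
  Num.min o%:R (m%:R + s) = (1 - s) * (minn o m)%:R + s * (minn o m.+1)%:R.
Proof.
move=> /andP[s0 s1]; have [om|mo] := leqP o m.
  have -> : minn o m.+1 = o by lia.
  by rewrite min_l; [ring|rewrite ler_wpDr // ler_nat].
have -> : minn o m.+1 = m.+1 by lia.
have mo' : m%:R + 1 <= o%:R :> R by rewrite natr1 ler_nat.
by rewrite -natr1 min_r; [ring|lra].
Qed.

(* Both sides are affine in [t] between consecutive integers, so it suffices to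
   compare them at the integers. *)
Lemma sum_min_le (R : archiRealFieldType) (I : finType) (o : I -> nat)
  (A B t : R) :
  (forall m, (\sum_i minn (o i) m)%:R <= A + m%:R * B) -> 0 <= t ->
  \sum_i Num.min (o i)%:R t <= A + t * B.
Proof.
move=> le_nat t0; pose m := Num.truncn t; pose s := t - m%:R.
have /andP[mt tm] := truncn_itv t0.
have s01 : 0 <= s <= 1 by rewrite /s -/m in mt tm *; rewrite -natr1 in tm; lra.
have -> : t = m%:R + s by rewrite /s; lra.
under eq_bigr do rewrite min_natr_interpolation //.
rewrite big_split /= -!mulr_sumr -!natr_sum.
have /andP[s0 s1] := s01.
have le_m := ler_wpM2l (_ : 0 <= 1 - s) (le_nat m); rewrite subr_ge0 in le_m.
have le_mS := ler_wpM2l s0 (le_nat m.+1).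
apply: le_trans (lerD (le_m s1) le_mS) _.
by rewrite -natr1; lra.
Qed.

Lemma powR_sum (R : realType) (I : finType) (x : R) (f : I -> R) : 0 < x ->
  x `^ (\sum_i f i) = \prod_i x `^ f i.
Proof.
move=> x0; under [RHS]eq_bigr do rewrite /powR gt_eqF //.
by rewrite /powR gt_eqF // mulr_suml expR_sum.
Qed.

Lemma prod_ge_powR (R : realType) (I : finType) (o : I -> nat) (A B X U : R)
  (W : I -> R) :
  (forall m, (\sum_i minn (o i) m)%:R <= A + m%:R * B) ->
  0 < X < 1 -> 0 < U < 1 ->
  (forall i, X ^+ o i <= W i) -> (forall i, U <= W i) ->
  X `^ A * U `^ B <= \prod_i W i.
Proof.
move=> le_nat /andP[X0 X1] /andP[U0 U1] XW UW; pose t := ln U / ln X.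
have lnX : ln X < 0 by rewrite ln_lt0 // X0.
have UE : U = X `^ t by rewrite /powR gt_eqF // /t divfK ?lt_eqF // lnK.
have t0 : 0 <= t.
  by rewrite /t ltW // -mulrNN -invrN divr_gt0 // oppr_gt0 // ln_lt0 // U0.
have XA : 0 < X <= 1 by rewrite X0 ltW.
rewrite UE -powRrM -powRD; last by rewrite (gt_eqF X0) implybT.
apply: le_trans (ger_powR XA (sum_min_le le_nat t0)) _.
rewrite powR_sum //; apply: ler_prod => i _; rewrite powR_ge0 /=.
have [le_t|lt_t] := leP (o i)%:R t; first by rewrite powR_mulrn ?XW // ltW.
by rewrite -UE.
Qed.

Section ClosestBranch.
Variables (R : realType) (M : nat) (L : 'I_M -> nat) (q : 'I_M -> {poly R})
  (l : R).
Hypotheses (q0 : forall j, (q j)`_0 = 0) (l0 : 0 < l).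
Implicit Types (j : 'I_M) (z : R * R) (f g : R * R -> R).

Definition closest_branch j z := [/\ z.1 != 0, height (q j) z != 0 &
  forall i, cmod (factor L q j z) <= cmod (factor L q i z)].

Definition weight j z : R := (`|z.1| * `|height (q j) z|) `^ l.

Definition dominated j f : Prop := exists K, \forall z \near (0 : R * R),
  closest_branch j z -> f z * weight j z <= K * cmod (Pval L q z.1 z.2).

Lemma dominated_le j f g : dominated j g ->
  (\forall z \near (0 : R * R), f z <= g z) -> dominated j f.
Proof.
move=> [K gK] fg; exists K; near=> z => jz.
have fgz : f z <= g z by near: z.
have gKz : g z * weight j z <= K * cmod (Pval L q z.1 z.2) by move: jz; near: z.
by apply: le_trans gKz; rewrite ler_wpM2r ?powR_ge0.
Unshelve. all: by end_near. Qed.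

Lemma dominatedZ j (a : R) f :
  0 <= a -> dominated j f -> dominated j (fun z => a * f z).
Proof.
move=> a0 [K fK]; exists (a * K); near=> z => jz.
by rewrite -!mulrA ler_wpM2l //; move: jz; near: z.
Unshelve. all: by end_near. Qed.

Lemma dominatedD j f g :
  dominated j f -> dominated j g -> dominated j (fun z => f z + g z).
Proof.
move=> [K fK] [K' gK]; exists (K + K'); near=> z => jz.
by rewrite !mulrDl lerD //; move: jz; near: z.
Unshelve. all: by end_near. Qed.

Lemma dominated_sum j (I : finType) (f : I -> R * R -> R) :
  (forall i, dominated j (f i)) -> dominated j (fun z => \sum_i f i z).
Proof.
move=> /choice[K fK]; exists (\sum_i K i); near=> z => jz.
rewrite !mulr_suml; apply: ler_sum => i _; move: i jz; near: z.
by apply: filter_forall.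
Unshelve. all: by end_near. Qed.

Lemma monomial_dominated j a b :
  (forall m, (m <= 2 * L j)%N ->
    (scale_sum (Oij L q) m j)%:R <= a%:R + m%:R * b%:R + m.+1%:R * l) ->
  dominated j (fun z => `|z.1| ^+ a * `|height (q j) z| ^+ b).
Proof.
move=> le_scale.
have /choice[C CP] : forall i, exists C,
    0 < C <= 1 /\ \forall z \near (0 : R * R),
    cmod (factor L q j z) <= cmod (factor L q i z) ->
    C * `|z.1| ^+ Oij L q i j <= cmod (factor L q i z).
  by move=> i; have [C ? ?] := factor_lower_bound L q i j; exists C.
have C01 i : 0 < C i <= 1 by have [] := CP i.
have C0 i : 0 < C i by have /andP[] := C01 i.
have C1 i : C i <= 1 by have /andP[] := C01 i.
have le_all m : (\sum_i minn (Oij L q i j) m)%:R <=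
  a%:R + l + m%:R * (b%:R + l).
  pose m' := minn m (2 * L j).
  have -> : (\sum_i minn (Oij L q i j) m = scale_sum (Oij L q) m' j)%N.
    by apply: eq_bigr => i _; have := Oij_le_r L q i j; rewrite /m'; lia.
  apply: le_trans (le_scale m' (geq_minr _ _)) _.
  have : m'%:R * (b%:R + l) <= m%:R * (b%:R + l).
    by rewrite ler_wpM2r ?addr_ge0 ?ler0n ?(ltW l0) // ler_nat geq_minl.
  by rewrite -natr1; lra.
exists (\prod_i (C i)^-1); near=> z => -[x0 u0 closest].
have x1 : `|z.1| < 1 by near: z; exact: near0_fst (nbhs0_lt ltr01).
have u1 : `|height (q j) z| < 1 by near: z; exact: near0_height.
have low i : C i * `|z.1| ^+ Oij L q i j <= cmod (factor L q i z).
  move: (closest i); move: i {closest}; near: z.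
  by apply: filter_forall => i; have [] := CP i.
have nx : 0 < `|z.1| by rewrite normr_gt0.
have nu : 0 < `|height (q j) z| by rewrite normr_gt0.
have -> : `|z.1| ^+ a * `|height (q j) z| ^+ b * weight j z =
    `|z.1| `^ (a%:R + l) * `|height (q j) z| `^ (b%:R + l).
  rewrite /weight powRM // !powRD ?(gt_eqF nx) ?(gt_eqF nu) ?implybT //.
  by rewrite !powR_mulrn ?ltW //; ring.
rewrite cmod_Pval -big_split /=.
apply: (prod_ge_powR le_all); rewrite ?nx ?nu // => i.
  by rewrite mulrC ler_pdivlMr // mulrC.
rewrite mulrC ler_pdivlMr //; apply: le_trans (closest i).
apply: le_trans (height_le_factor _ _ _ _); rewrite ler_piMr //.
Unshelve. all: by end_near. Qed.

Lemma reval_dominated j c r : 0 < r -> absconv c r ->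
  (forall m a b, (m <= 2 * L j)%N -> branch_series (q j) c a b != 0 ->
    (scale_sum (Oij L q) m j)%:R <= a%:R + m%:R * b%:R + m.+1%:R * l) ->
  dominated j (fun z => `|reval c z.1 z.2|).
Proof.
move=> r0 cr le_scale; set h := branch_series (q j) c in le_scale.
have [s [s0 hs evs]] := branch_series_eval r0 cr (q0 j).
pose D := (\sum_i 2 * L i).+1; have [T T0 tail] := reval_truncation_le D s0 hs.
have scale_le m : (scale_sum (Oij L q) m j < D)%N.
  by apply: leq_sum => i _; apply: leq_trans (geq_minl _ _) (Oij_le_l _ _ _ _).
pose mono a b z := `|z.1| ^+ a * `|height (q j) z| ^+ b.
have mono_x : dominated j (mono D 0%N).
  apply: monomial_dominated => m _;
    rewrite mulr0 addr0 ler_wpDr ?mulr_ge0 ?(ltW l0) //.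
  by rewrite ler_nat ltnW.
have mono_u : dominated j (mono 0%N D).
  apply: monomial_dominated => m _;
    rewrite add0r ler_wpDr ?mulr_ge0 ?(ltW l0) //.
  case: m => [|m]; first by rewrite scale_sum0 mul0r.
  by rewrite -natrM ler_nat (leq_trans (ltnW (scale_le _))) // leq_pmull.
have head : dominated j
  (fun z => \sum_(a < D) \sum_(b < D) `|h a b| * mono a b z).
  apply: (dominated_sum (f := fun (a : 'I_D) z => \sum_(b < D) _)) => a.
  apply: (dominated_sum (f := fun (b : 'I_D) z => _)) => b.
  have [->|hab] := eqVneq (h a b) 0; last first.
    by apply: dominatedZ => //; apply: monomial_dominated => m mL;
      exact: le_scale.
  by exists 0; near=> z => _; rewrite normr0 !mul0r.
have dom := dominatedD head (dominatedZ T0 (dominatedD mono_x mono_u)).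
apply: dominated_le dom _.
near=> z.
have xs : `|z.1| <= s by apply: ltW; near: z; exact: near0_fst (nbhs0_lt s0).
have us : `|height (q j) z| <= s by apply: ltW; near: z; exact: near0_height.
have <- : reval h z.1 (height (q j) z) = reval c z.1 z.2
  by rewrite evs // /height addrK.
rewrite /mono !expr0 mulr1 mul1r -lerBlDl.
apply: le_trans (tail _ _ xs us); apply: le_trans (lerB_dist _ _);
  rewrite lerB //.
apply: le_trans (ler_norm_sqsum _ _) _.
apply: ler_sum => a _; apply: ler_sum => b _.
by rewrite /pterm !normrM !normrX -mulrA.
Unshelve. all: by end_near. Qed.

End ClosestBranch.

(** * Integrability *)

Section Translation.
Variable R : realType.
Notation mu := (@lebesgue_measure R).

Lemma measurable_shift (s : R) : measurable_fun setT (fun y : R => y + s).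
Proof. exact: measurable_funD. Qed.

Lemma lebesgue_measure_shift (s : R) (A : set R) : measurable A ->
  pushforward mu ((fun y => y + s) : _ -> measurableTypeR R) A = mu A.
Proof.
move=> mA; apply/esym/lebesgue_measure_unique => //=;
  first exact: measurable_shift.
move=> mshift _ [[a b]] _ <-; rewrite /pushforward.
have -> : (fun y => y + s) @^-1` `]a, b] = `]a - s, b - s]%classic :> set R.
  by apply/seteqP; split=> y; rewrite /= !in_itv /= => ?; lra.
rewrite !lebesgue_measure_itv /= !lte_fin ltrD2r -!EFinB.
by case: ifP => // _; congr EFin; lra.
Qed.

Lemma ge0_integral_shift (s : R) (f : R -> \bar R) : measurable_fun setT f ->
  (forall y, (0 <= f y)%E) ->
  (\int[mu]_y f (y + s)%R = \int[mu]_y f y)%E.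
Proof.
move=> mf f0.
pose shift_s : measurableTypeR R -> measurableTypeR R := fun y => y + s.
have mshift : measurable_fun setT shift_s := @measurable_shift s.
transitivity (\int[pushforward mu shift_s]_y f y)%E.
  by rewrite (ge0_integral_pushforward mshift).
by apply: eq_measure_integral => A mA _; exact: lebesgue_measure_shift.
Qed.

End Translation.

Lemma nneseries_pinfty_ge (R : realType) (u : nat -> \bar R) (e : R) : 0 < e ->
  (forall k, (e%:E <= u k)%E) -> (\sum_(0 <= k <oo) u k = +oo)%E.
Proof.
move=> e0 ue.
have u0 k : (0 <= u k)%E by apply: le_trans (ue k); rewrite lee_fin ltW.
apply/eqyP => A A0; near \oo => n.
apply: le_trans (nneseries_lim_ge n _); last by move=> k _ _; exact: u0.
apply: (@le_trans _ _ (\sum_(0 <= k < n) e%:E)%E); last exact: lee_sum.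
rewrite sumEFin lee_fin sumr_const_nat subn0 -mulr_natl -ler_pdivrMr //.
by near: n; exact: nbhs_infty_ger.
Unshelve. all: by end_near. Qed.

Section Pole.
Variables (R : realType) (theta : R).
Notation mu := (@lebesgue_measure R).

Definition pole_step (k : nat) (t : R) : \bar R :=
  (((2 ^+ k.+1) `^ theta)%:E *
   (\1_(`[- (2 ^- k), 2 ^- k]%classic : set R) t)%:E)%E.

(* An integrable majorant of [|t|^-theta] on [|t| < 1], infinite at 0, so that
   no null set has to be discarded in pointwise comparisons. *)
Definition pole (t : R) : \bar R := (\sum_(0 <= k <oo) pole_step k t)%E.

Lemma pole_step_ge0 k t : (0 <= pole_step k t)%E.
Proof. by rewrite mule_ge0 // lee_fin ?powR_ge0 // indicE ler0n. Qed.

Lemma pole_ge0 t : (0 <= pole t)%E.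
Proof. by apply: nneseries_ge0 => k _ _; exact: pole_step_ge0. Qed.

Lemma measurable_pole_step k : measurable_fun setT (pole_step k).
Proof.
apply: emeasurable_funM; first exact: measurable_cst.
by apply/measurable_EFinP; apply: measurable_indic; exact: measurable_itv.
Qed.

Lemma measurable_pole : measurable_fun setT pole.
Proof.
apply: (@ge0_emeasurable_sum _ _ _ setT pole_step predT) => k *.
  exact: pole_step_ge0.
exact: measurable_pole_step.
Qed.

Lemma pole_step_le k t : (pole_step k t <= pole t)%E.
Proof.
apply: le_trans (nneseries_lim_ge k.+1 _);
  last by move=> *; exact: pole_step_ge0.
rewrite big_nat_recr //=; apply: leeDr.
by apply: sume_ge0 => i _; exact: pole_step_ge0.
Qed.

Lemma pole_stepE k t : `|t| <= 2 ^- k ->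
  pole_step k t = ((2 ^+ k.+1) `^ theta)%:E.
Proof.
by move=> tk; rewrite /pole_step indicE mem_set ?mule1 //= in_itv /= -ler_norml.
Qed.

Lemma integral_pole_step k : (\int[mu]_y pole_step k y)%E =
  (geometric (2 * 2 `^ theta) (2 `^ theta / 2) k)%:E.
Proof.
rewrite /pole_step ge0_integralZl_EFin ?powR_ge0 //; last first.
  by apply/measurable_EFinP; apply: measurable_indic; exact: measurable_itv.
have -> : (\int[mu]_y (\1_(`[- (2 ^- k), 2 ^- k]%classic : set R) y)%:E =
  (2 * 2 ^- k)%:E)%E.
  rewrite integral_indic //= setIT; etransitivity;
    first exact: lebesgue_measure_itv.
  have e0 : 0 < (2 ^- k : R) by rewrite invr_gt0 exprn_gt0.
  rewrite /= lte_fin ifT; last by lra.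
  by rewrite -EFinB; congr EFin; lra.
rewrite -EFinM /geometric /=; congr EFin.
have -> : (2 ^+ k.+1 : R) `^ theta = 2 `^ theta * (2 `^ theta) ^+ k.
  rewrite exprS powRM ?exprn_ge0 //; congr (_ * _).
  by rewrite -powR_mulrn // -powRrM mulrC powRrM powR_mulrn ?powR_ge0.
by rewrite expr_div_n; ring.
Qed.

Hypothesis theta1 : theta < 1.

Lemma integral_pole_lty : (\int[mu]_y pole y < +oo)%E.
Proof.
rewrite integral_nneseries //;
  [|exact: measurable_pole_step|by move=> *; exact: pole_step_ge0].
under eq_eseriesr do rewrite integral_pole_step.
have ratio_gt0 : 0 < 2 `^ theta / 2 :> R by rewrite divr_gt0 // powR_gt0.
have ratio_lt1 : 2 `^ theta / 2 < 1 :> R.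
  rewrite ltr_pdivrMr // mul1r /powR pnatr_eq0 /= -[ltRHS]lnK ?posrE //
    ltr_expR.
  by rewrite gtr_pMl // ln_gt0 // ltr1n.
have ratio_norm : `|2 `^ theta / 2| < 1 :> R by rewrite gtr0_norm.
apply: (@le_lt_trans _ _ (2 * 2 `^ theta * (1 - 2 `^ theta / 2)^-1)%:E);
  last exact: ltry.
apply: lime_le.
  by apply: is_cvg_nneseries => k _ _;
    rewrite lee_fin /= mulr_ge0 ?exprn_ge0 ?mulr_ge0 ?powR_ge0 // ltW.
apply: nearW => n; rewrite sumEFin lee_fin.
by apply: (geometric_le_lim n) => //; rewrite mulr_ge0 ?powR_ge0.
Qed.

Hypothesis theta0 : 0 < theta.

Lemma pole_lower_bound t : 0 < `|t| < 1 ->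
  (((`|t| `^ theta)^-1)%:E <= pole t)%E.
Proof.
move=> /andP[t0 t1].
have exk : exists k, 2 ^- k.+1 < `|t|.
  exists (Num.truncn `|t|^-1); rewrite invf_plt ?posrE ?exprn_gt0 //.
  apply: lt_le_trans (truncnS_gt _) _.
  by rewrite -natrX ler_nat ltnW // ltn_expl.
case: (ex_minnP exk) => k kt kmin.
have tk : `|t| <= 2 ^- k.
  case: k kt kmin => [|k] kt kmin; first by rewrite expr0 invr1 ltW.
  by rewrite leNgt; apply/negP => /kmin; rewrite ltnn.
apply: le_trans (pole_step_le k t); rewrite pole_stepE // lee_fin.
have -> : (`|t| `^ theta)^-1 = `|t|^-1 `^ theta.
  by rewrite -[in RHS]powR_inv1 // -powRrM mulN1r powRN.
rewrite ge0_ler_powR ?nnegrE ?invr_ge0 ?exprn_ge0 // ?ltW //.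
by rewrite invf_plt ?posrE ?exprn_gt0.
Qed.

Lemma pole0 : pole 0 = +oo%E.
Proof.
apply: (nneseries_pinfty_ge ltr01) => k.
rewrite pole_stepE ?normr0 ?invr_ge0 ?exprn_ge0 // lee_fin.
rewrite -[leLHS](_ : 1 `^ theta = 1); last by rewrite powR1.
rewrite ge0_ler_powR ?nnegrE ?exprn_ge0 ?(ltW theta0) //.
by rewrite exprn_ege1 // ler1n.
Qed.

Lemma pole_gt0 t : `|t| < 1 -> (0 < pole t)%E.
Proof.
move=> t1; have [->|t0] := eqVneq t 0; first by rewrite pole0.
apply: lt_le_trans (pole_lower_bound _); last by rewrite normr_gt0 t0.
by rewrite lte_fin invr_gt0 powR_gt0 // normr_gt0.
Qed.

End Pole.

Section Measurability.
Variable R : realType.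
Notation mu := (@lebesgue_measure R).
Implicit Types (D : set (R * R)) (f g : R * R -> R[i]).

Lemma measurable_height (g : {poly R}) : measurable_fun setT (height g).
Proof.
apply: measurable_funD; first exact: measurable_snd.
apply: (measurableT_comp (f := fun x : R => g.[x])); last exact: measurable_fst.
apply: continuous_measurable_fun; exact: continuous_horner.
Qed.

Definition cmeasurable D f :=
  measurable_fun D (fun z => complex.Re (f z)) /\
  measurable_fun D (fun z => complex.Im (f z)).

Lemma cmeasurableM D f g : cmeasurable D f -> cmeasurable D g ->
  cmeasurable D (fun z => f z * g z).
Proof.
move=> [fr fi] [gr gi]; split.
  rewrite [X in measurable_fun _ X](_ : _ =
      fun z => complex.Re (f z) * complex.Re (g z) -
      complex.Im (f z) * complex.Im (g z)).
    by apply: measurable_funB; apply: measurable_funM.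
  by apply/funext => z; case: (f z) (g z) => [a b] [c d].
rewrite [X in measurable_fun _ X](_ : _ =
    fun z => complex.Re (f z) * complex.Im (g z) +
    complex.Im (f z) * complex.Re (g z)).
  by apply: measurable_funD; apply: measurable_funM.
by apply/funext => z; case: (f z) (g z) => [a b] [c d].
Qed.

Lemma cmeasurable_prod D (I : Type) (s : seq I) (F : I -> R * R -> R[i]) :
  (forall i, cmeasurable D (F i)) ->
  cmeasurable D (fun z => \prod_(i <- s) F i z).
Proof.
move=> mF; elim: s => [|i s IH].
  by under eq_fun do rewrite big_nil; split; exact: measurable_cst.
by under eq_fun do rewrite big_cons; exact: cmeasurableM.
Qed.

Lemma cmeasurableV D f : cmeasurable D f -> cmeasurable D (fun z => (f z)^-1).
Proof.
move=> [fr fi]; pose N z := complex.Re (f z) ^+ 2 + complex.Im (f z) ^+ 2.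
have mNV : measurable_fun D (fun z => (N z)^-1).
  under eq_fun => z do rewrite -powR_inv1 ?addr_ge0 ?sqr_ge0 //.
  apply: (measurableT_comp (measurable_powR (-1))).
  by apply: measurable_funD; apply: measurable_funX.
split.
  rewrite [X in measurable_fun _ X](_ : _ =
      fun z => complex.Re (f z) * (N z)^-1).
    exact: measurable_funM.
  by apply/funext => z; rewrite /N; case: (f z).
rewrite [X in measurable_fun _ X](_ : _ =
    fun z => - complex.Im (f z) * (N z)^-1).
  by apply: measurable_funM => //; exact: measurable_funN.
by apply/funext => z; rewrite /N; case: (f z) => a b /=; rewrite mulNr.
Qed.

Lemma measurable_cmod_powR D f (p : R) : cmeasurable D f ->
  measurable_fun D (fun z => ((cmod (f z)) `^ p)%:E).
Proof.
move=> [fr fi]; apply/measurable_EFinP;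
  apply: (measurableT_comp (measurable_powR p)).
apply: (measurableT_comp (f := @Num.sqrt R)).
  apply: continuous_measurable_fun; exact: sqrt_continuous.
by apply: measurable_funD; apply: measurable_funX.
Qed.

Lemma cmeasurable_Pval M (L : 'I_M -> nat) (q : 'I_M -> {poly R}) D :
  cmeasurable D (fun z => Pval L q z.1 z.2).
Proof.
apply: cmeasurable_prod => i; split; apply: measurable_funTS.
  exact: measurable_height.
by apply: measurable_funX; exact: measurable_fst.
Qed.

Lemma measurable_box (e : R) : measurable (box e).
Proof.
have -> : box e = ((fst : R * R -> R) @^-1` `]-e, e[) `&`
                  ((snd : R * R -> R) @^-1` `]-e, e[).
  by apply/seteqP; split=> [z [? ?]|z [/= + +]];
    rewrite /= ?in_itv /= -!ltr_norml.
apply: measurableI; rewrite -[X in measurable X]setTI.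
  by apply: (@measurable_fst _ _ R R) => //; exact: measurable_itv.
by apply: (@measurable_snd _ _ R R) => //; exact: measurable_itv.
Qed.

Lemma measurable_reval (c : nat -> nat -> R) (r : R) : 0 < r -> absconv c r ->
  measurable_fun (box r) (fun z => reval c z.1 z.2).
Proof.
move=> r0 cr; apply: (measurable_fun_cvg
  (h := fun N z => sqsum (pterm c z.1 z.2) N)).
  move=> N; do 2 apply: measurable_sum => ?.
  apply: measurable_funM; first apply: measurable_funM.
  - exact: measurable_cst.
  - by apply: measurable_funX; apply: measurable_funTS; exact: measurable_fst.
  by apply: measurable_funX; apply: measurable_funTS; exact: measurable_snd.
move=> z [z1 z2]; apply/dsummable_cvg/(pterm_dsummable cr);
  by rewrite (gtr0_norm r0) ltW.
Qed.

Lemma integral_pole_height_lty (theta : R) (g : {poly R}) : theta < 1 ->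
  (\int[mu \x mu]_z (pole theta z.1 * pole theta (height g z)) < +oo)%E.
Proof.
move=> theta1; pose Z := (\int[mu]_y pole theta y)%E.
have mpole := measurable_pole theta.
have mprod : measurable_fun setT
  (fun z : R * R => pole theta z.1 * pole theta (height g z))%E.
  apply: emeasurable_funM.
    by apply: measurableT_comp => //; exact: measurable_fst.
  by apply: (measurableT_comp mpole); exact: measurable_height.
have Z_ge0 : (0 <= Z)%E by apply: integral_ge0 => y _; exact: pole_ge0.
have Z_fin : Z \is a fin_num by rewrite ge0_fin_numE // integral_pole_lty.
have inner x :
  (\int[mu]_y (pole theta x * pole theta (y + g.[x])%R) = pole theta x * Z)%E.
  have mline : measurable_fun setT (fun y : R => pole theta (y + g.[x])).
    by apply: (measurableT_comp mpole); exact: measurable_shift.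
  rewrite ge0_integralZl; [|exact: measurableT|exact: mline|move=> y _|];
    try exact: pole_ge0.
  by rewrite (ge0_integral_shift _ mpole (pole_ge0 theta)).
rewrite fubini_tonelli1 //; last by move=> z; rewrite mule_ge0 // pole_ge0.
rewrite /fubini_F /height /=; under eq_integral do rewrite inner.
rewrite ge0_integralZr;
  [|exact: measurableT|exact: mpole|by move=> *; exact: pole_ge0|by []].
by rewrite -/Z -(fineK Z_fin) -EFinM ltry.
Qed.

End Measurability.

Section RealParts.
Variable R : realType.
Implicit Types Q : cpseries R.

Definition part (b : bool) Q (i j : nat) : R :=
  if b then complex.Im (Q i j) else complex.Re (Q i j).

Lemma ps_evalE Q x y :
  ps_eval Q x y = (reval (part false Q) x y +i* reval (part true Q) x y)%C.
Proof. by []. Qed.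

Lemma norm_reval_part_le b Q x y :
  `|reval (part b Q) x y| <= cmod (ps_eval Q x y).
Proof.
by case: b;
  [exact: (Im_le_cmod (ps_eval Q x y))|exact: (Re_le_cmod (ps_eval Q x y))].
Qed.

Lemma cmod_ps_eval_le Q x y :
  cmod (ps_eval Q x y) <= \sum_b `|reval (part b Q) x y|.
Proof. by rewrite big_bool /= addrC; exact: cmod_le. Qed.

Lemma absconv_part Q : ps_convergent Q ->
  exists2 r, 0 < r & forall b, absconv (part b Q) r.
Proof.
move=> [r [r0 [B QB]]]; exists r => // b; apply: (@dsummable_bound _ _ B) => N.
apply: le_trans (QB N); apply: ler_sum => i _; apply: ler_sum => j _.
rewrite /pterm -mulrA -exprD normrM (gtr0_norm (exprn_gt0 _ r0)) ler_wpM2r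
  ?exprn_ge0 ?(ltW r0) //.
by case: b; [exact: Im_le_cmod|exact: Re_le_cmod].
Qed.

Lemma ps_convergent_part Q r :
  0 < r -> (forall b, absconv (part b Q) r) -> ps_convergent Q.
Proof.
move=> r0 cQ; exists r; split=> //.
exists (\sum_b dsum (fun i j => `|pterm (part b Q) r r i j|)) => N.
apply: (@le_trans _ _
  (\sum_b sqsum (fun i j => `|pterm (part b Q) r r i j|) N)).
  rewrite big_bool /sqsum -big_split /=; apply: ler_sum => i _.
  rewrite -big_split /=; apply: ler_sum => j _.
  rewrite /pterm -!mulrA -exprD !normrM (gtr0_norm (exprn_gt0 _ r0)) -mulrDl.
  by rewrite ler_wpM2r ?exprn_ge0 ?(ltW r0) // addrC cmod_le.
by apply: ler_sum => b _; exact: sqsum_norm_le_dsum N (cQ b).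
Qed.

End RealParts.

Section Sufficiency.
Variable R : realType.
Notation mu := (@lebesgue_measure R).

Lemma Lp_loc_le (p r : R) (f : R * R -> R[i]) (g : R * R -> \bar R) :
  0 < r -> cmeasurable (box r) f ->
  measurable_fun setT g -> (forall z, (0 <= g z)%E) ->
  (\int[mu \x mu]_z g z < +oo)%E ->
  (\forall z \near (0 : R * R), (((cmod (f z)) `^ p)%:E <= g z)%E) ->
  Lp_loc p f.
Proof.
move=> r0 mf mg g0 g_fin /near0_boxP[e e0 fg]; pose d := Num.min e r.
have box_le (e' : R) : d <= e' -> box d `<=` box e'.
  by move=> de z [z1 z2]; split; exact: lt_le_trans de.
have mfd : cmeasurable (box d) f.
  have dr : d <= r by rewrite ge_min lexx orbT.
  by have [fr fi] := mf; split;
    apply: (measurable_funS (measurable_box r) (box_le r dr)).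
exists (box d); split; first by exists d; rewrite lt_min e0; split=> // z.
split; first exact: measurable_box.
have [fr fi] := mfd; do 2 split => //; apply: le_lt_trans g_fin.
apply: (@le_trans _ _ (\int[mu \x mu]_(z in box d) g z)%E).
  apply: ge0_le_integral => //.
  - exact: measurable_box.
  - by move=> z _; rewrite lee_fin powR_ge0.
  - exact: measurable_cmod_powR.
  - exact: measurable_funTS.
  by move=> z dz; apply/fg/(box_le e _ z dz); rewrite ge_min lexx.
by apply: ge0_subset_integral => //; exact: measurable_box.
Qed.

Lemma quotient_powR_le_pole (l p K a b x u : R) : 0 < l -> 0 < p -> 0 < K ->
  0 <= a -> 0 <= b -> `|x| < 1 -> `|u| < 1 ->
  (x != 0 -> u != 0 -> a * (`|x| * `|u|) `^ l <= K * b) ->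
  (((a / b) `^ p)%:E <= (K `^ p)%:E * (pole (l * p) x * pole (l * p) u))%E.
Proof.
move=> l0 p0 K0 a0 b0 x1 u1 ab; have th0 : 0 < l * p by rewrite mulr_gt0.
have Kp0 : (0 < (K `^ p)%:E)%E by rewrite lte_fin powR_gt0.
have [x0|x0] := eqVneq x 0.
  by rewrite x0 pole0 // gt0_mulye ?pole_gt0 // gt0_muley // leey.
have [u0|u0] := eqVneq u 0.
  by rewrite u0 pole0 // gt0_muley ?pole_gt0 // gt0_muley // leey.
have nx : 0 < `|x| by rewrite normr_gt0.
have nu : 0 < `|u| by rewrite normr_gt0.
apply: (@le_trans _ _
  ((K `^ p)%:E * (((`|x| `^ (l * p))^-1)%:E * ((`|u| `^ (l * p))^-1)%:E))%E);
    last first.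
  apply: lee_wpmul2l; first exact: ltW.
  by apply: lee_pmul; rewrite ?lee_fin ?invr_ge0 ?powR_ge0 ?pole_lower_bound
    ?nx ?nu.
rewrite -!EFinM lee_fin -invfM -powRM // powRrM ler_pdivlMr ?powR_gt0
  ?mulr_gt0 //.
rewrite -powRM ?divr_ge0 ?powR_ge0 //.
rewrite ge0_ler_powR ?nnegrE ?mulr_ge0 ?invr_ge0 ?powR_ge0 ?(ltW p0)
  ?(ltW K0) //.
rewrite mulrAC; have [->|b_neq0] := eqVneq b 0;
  first by rewrite invr0 mulr0 ltW.
by rewrite ler_pdivrMr ?ab // lt_def b_neq0.
Qed.

Lemma subcritical_exponent (p : R) (B : nat) : 0 < p ->
  exists l, [/\ 0 < l, l * p < 1 & forall s m, (s <= B)%N -> (m <= B)%N ->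
    subcritical p m s -> s%:R <= m.+1%:R * l].
Proof.
move=> p0; pose ratio (z : 'I_B.+1 * 'I_B.+1) : R := z.1%:R / z.2.+1%:R.
pose admissible (z : 'I_B.+1 * 'I_B.+1) := subcritical p z.2 z.1.
exists (\big[Num.max/(2 * p)^-1]_(z | admissible z) ratio z); split.
- by apply: lt_le_trans (bigmax_ge_id _ _ _ _); rewrite invr_gt0 mulr_gt0.
- rewrite -ltr_pdivlMr // div1r; apply: bigmax_lt.
    by rewrite ltf_pV2 ?posrE ?mulr_gt0 //; lra.
  by move=> [s m] /= sub;
    rewrite /ratio ltr_pdivrMr ?ltr0Sn // mulrC ltr_pdivlMr.
move=> s m; rewrite -ltnS => sB; rewrite -ltnS => mB sub.
rewrite mulrC -ler_pdivrMr ?ltr0Sn //.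
exact: (le_bigmax_cond (P := admissible) _ ratio
  (sub : admissible (Ordinal sB, Ordinal mB))).
Qed.

Variables (M : nat) (L : 'I_M -> nat) (q : 'I_M -> {poly R}) (p : R)
  (Q : cpseries R).
Hypotheses (M0 : (0 < M)%N) (q0 : forall j, (q j)`_0 = 0) (p0 : 0 < p).
Hypothesis cQ : ps_convergent Q.
Hypothesis sub : forall b j m a a', (m <= 2 * L j)%N ->
  branch_series (q j) (part b Q) a a' != 0 ->
  subcritical p m (scale_sum (Oij L q) m j - (a + m * a')).

Lemma ps_eval_dominated : exists2 l, 0 < l & l * p < 1 /\
  forall j, dominated L q l j (fun z => cmod (ps_eval Q z.1 z.2)).
Proof.
pose S := (\sum_i 2 * L i)%N.
have [l [l0 lp le_l]] := subcritical_exponent S p0.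
have [r r0 cr] := absconv_part cQ.
exists l => //; split=> // j.
have dom : dominated L q l j (fun z => \sum_b `|reval (part b Q) z.1 z.2|).
  apply: (dominated_sum (f := fun b z => `|reval (part b Q) z.1 z.2|)) => b.
  apply: (reval_dominated q0 l0 r0 (cr b)) => m a a' mL nz.
  have S_ge : (scale_sum (Oij L q) m j <= S)%N.
    by apply: leq_sum => i _;
      apply: leq_trans (geq_minl _ _) (Oij_le_l _ _ _ _).
  have mS : (m <= S)%N by rewrite (leq_trans mL) // /S (bigD1 j) //= leq_addr.
  rewrite -natrM -natrD -lerBlDl.
  apply: le_trans (le_l _ _ (leq_trans (leq_subr _ _) S_ge) mS (sub mL nz)).
  by rewrite lerBlDl -natrD ler_nat -leq_subLR.
by apply: dominated_le dom _; near=> z; exact: cmod_ps_eval_le.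
Unshelve. all: by end_near. Qed.

Lemma closest_branch_exists (z : R * R) :
  exists j, forall i, cmod (factor L q j z) <= cmod (factor L q i z).
Proof.
exists [arg min_(i < Ordinal M0) cmod (factor L q i z)]%O.
by case: arg_minP => // j _ jmin i; exact: jmin.
Qed.

Lemma Lp_loc_of_subcritical :
  Lp_loc p (fun z => ps_eval Q z.1 z.2 / Pval L q z.1 z.2).
Proof.
have [l l0 [lp /choice[K domK]]] := ps_eval_dominated.
have [r r0 cr] := absconv_part cQ.
pose K' := 1 + \sum_j `|K j|; have K'0 : 0 < K' by rewrite ltr_wpDr // sumr_ge0.
have KK' j : K j <= K'.
  rewrite /K' (bigD1 j) //= addrCA; apply: le_trans (ler_norm _) _.
  by rewrite lerDl addr_ge0 ?sumr_ge0.
pose F j (z : R * R) : \bar R :=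
  (pole (l * p) z.1 * pole (l * p) (height (q j) z))%E.
have F0 j z : (0 <= F j z)%E by rewrite mule_ge0 ?pole_ge0.
have mF j : measurable_fun setT (F j).
  by apply: emeasurable_funM; apply: (measurableT_comp (measurable_pole _));
    [exact: measurable_fst|exact: measurable_height].
apply: (@Lp_loc_le _ r _ (fun z => (K' `^ p)%:E * \sum_j F j z)%E) => //.
- apply: cmeasurableM; last exact: cmeasurableV (cmeasurable_Pval _ _ _).
  split; first exact: measurable_reval r0 (cr false).
  exact: measurable_reval r0 (cr true).
- by apply: emeasurable_funM; [exact: measurable_cst|exact: emeasurable_sum].
- by move=> z; rewrite mule_ge0 ?lee_fin ?powR_ge0 // sume_ge0.
- rewrite ge0_integralZl_EFin ?powR_ge0 //.
  + rewrite ge0_integral_sum //; apply: lte_mul_pinfty;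
      rewrite ?lee_fin ?powR_ge0 //.
    by apply: lte_sum_pinfty => j _; exact: integral_pole_height_lty.
  + by move=> z _; rewrite sume_ge0.
  + exact: emeasurable_sum.
near=> z.
have [j jmin] := closest_branch_exists z.
apply: (@le_trans _ _ ((K' `^ p)%:E * F j z)%E); last first.
  apply: lee_wpmul2l; first by rewrite lee_fin powR_ge0.
  by rewrite (bigD1 j) //= leeDl // sume_ge0.
rewrite cmod_div; apply: quotient_powR_le_pole; rewrite ?cmod_ge0 //.
- by near: z; exact: near0_fst (nbhs0_lt ltr01).
- by move: j {jmin}; near: z; apply: filter_forall => j; exact: near0_height.
move=> x0 u0; apply: (@le_trans _ _ (K j * cmod (Pval L q z.1 z.2))).
  have : closest_branch L q j z by split.
  by move: j {jmin u0}; near: z; apply: filter_forall.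
by rewrite ler_wpM2r ?cmod_ge0.
Unshelve. all: by end_near. Qed.

End Sufficiency.

(** * Divergence along a branch *)

Lemma ge0_integral_pinfty_bigcup d (T : measurableType d) (R : realType)
    (mu : {measure set T -> \bar R}) (U : set T) (H : nat -> set T)
    (g : T -> \bar R) (e : R) :
  measurable U -> measurable_fun U g -> (forall x, U x -> (0 <= g x)%E) ->
  (forall k, measurable (H k)) -> (forall k, H k `<=` U) -> trivIset setT H ->
  0 < e -> (forall k, (e%:E <= \int[mu]_(x in H k) g x)%E) ->
  (\int[mu]_(x in U) g x = +oo)%E.
Proof.
move=> mU mg g0 mH HU tH e0 He.
have HU' : \bigcup_k H k `<=` U by move=> x [k _ /HU].
apply/eqP; rewrite -leye_eq.
rewrite -(nneseries_pinfty_ge e0 He) -ge0_integral_bigcup //.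
- by apply: ge0_subset_integral => //; exact: bigcup_measurable.
- exact: measurable_funS mg.
- by move=> x /HU' /g0.
Qed.

Lemma near_right0_itv (R : realType) (P : set R) :
  (\forall x \near (0 : R)^'+, P x) ->
  exists2 d, 0 < d & forall x, 0 < x <= d -> P x.
Proof.
move=> /nbhs_ballP[e /= e0 eP]; exists (e / 2) => [|x /andP[x0 xe]];
  first by rewrite divr_gt0.
by apply: eP => //; rewrite /ball /= sub0r normrN gtr0_norm //; lra.
Qed.

Section Horn.
Variables (R : realType) (q : {poly R}) (n : nat) (tau : R).
Hypothesis tau0 : 0 < tau.
Notation mu := (@lebesgue_measure R).
Implicit Types (a b x : R) (z : R * R).

Definition horn a b : set (R * R) :=
  [set z | a < z.1 <= b /\ tau * z.1 ^+ n <= height q z <= 2 * tau * z.1 ^+ n].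

Lemma horn_param a b z : 0 <= a -> horn a b z ->
  exists2 t, tau <= t <= 2 * tau & z = (z.1, z.1 ^+ n * t - q.[z.1]).
Proof.
move=> a0 [/andP[az _] /andP[ge_tau le_tau]].
have zn : 0 < z.1 ^+ n by rewrite exprn_gt0 // (le_lt_trans a0).
exists (height q z / z.1 ^+ n);
  first by rewrite ler_pdivlMr // ler_pdivrMr // ge_tau.
by rewrite mulrC divfK ?gt_eqF // /height addrK; case: z {az ge_tau le_tau zn}.
Qed.

Lemma measurable_horn a b : measurable (horn a b).
Proof.
have mXn c : measurable_fun setT (fun z : R * R => c * z.1 ^+ n).
  by apply: measurable_funM;
    [exact: measurable_cst|apply: measurable_funX; exact: measurable_fst].
have mh := measurable_height q.
have -> : horn a b = ((fst : R * R -> R) @^-1` `]a, b]) `&`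
   ((fun z => height q z - tau * z.1 ^+ n) @^-1` `[0, +oo[) `&`
   ((fun z => 2 * tau * z.1 ^+ n - height q z) @^-1` `[0, +oo[).
  apply/seteqP; split=> [z [z_ab /andP[ge_tau le_tau]]|z [[/= + +] +]];
    rewrite /= !in_itv /= ?andbT ?subr_ge0 //.
  by move=> z_ab ge_tau le_tau; split=> //; rewrite ge_tau le_tau.
apply: measurableI; first apply: measurableI; rewrite -[X in measurable X]setTI.
- by apply: (@measurable_fst _ _ R R) => //; exact: measurable_itv.
- by apply: (measurable_funB mh (mXn tau)) => //; exact: measurable_itv.
- by apply: (measurable_funB (mXn _) mh) => //; exact: measurable_itv.
Qed.

Lemma xsection_horn a b x : a < x <= b -> xsection (horn a b) x =
  `[tau * x ^+ n - q.[x], 2 * tau * x ^+ n - q.[x]]%classic.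
Proof.
move=> axb; apply/seteqP; split=> y;
  rewrite /xsection /= in_itv /= /horn /height.
  by move=> /set_mem[_ /= /andP[ge_tau le_tau]]; apply/andP; split; lra.
move=> /andP[ge_tau le_tau]; apply/mem_set; split=> //=.
by apply/andP; split; lra.
Qed.

Lemma measure_horn_ge a b : 0 <= a -> a <= b ->
  ((tau * a ^+ n * (b - a))%:E <= (mu \x mu)%E (horn a b))%E.
Proof.
move=> a0 ab; have c0 : 0 <= tau * a ^+ n by rewrite mulr_ge0 ?exprn_ge0 // ltW.
have -> : (tau * a ^+ n * (b - a))%:E =
    (\int[mu]_(x in `]a, b]) (tau * a ^+ n)%:E)%E.
  rewrite integral_cst //= lebesgue_measure_itv /= lte_fin EFinM;
    congr (_ * _)%E.
  case: ltP => // ba; have -> : a = b by apply/eqP; rewrite eq_le ab.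
  by rewrite subrr.
rewrite /= /product_measure1 /=.
apply: (@le_trans _ _ (\int[mu]_(x in `]a, b]) mu (xsection (horn a b) x))%E);
  last first.
  apply: ge0_subset_integral => //.
  exact: (measurable_fun_xsection mu (measurable_horn a b)).
apply: ge0_le_integral => //.
- apply: measurable_funTS.
  exact: (measurable_fun_xsection mu (measurable_horn a b)).
move=> x; rewrite /= in_itv /= => axb; rewrite xsection_horn //.
have /andP[ax _] := axb.
have le_xn : tau * a ^+ n <= tau * x ^+ n.
  by rewrite ler_wpM2l ?(ltW tau0) // lerXn2r ?nnegrE // ltW //
    (le_lt_trans a0).
rewrite lebesgue_measure_itv /= lte_fin; case: ltP => lt_ends.
  by rewrite -EFinB lee_fin; lra.
by rewrite lee_fin; lra.
Qed.

Lemma integral_horn_ge a kappa (g : R * R -> \bar R) : 0 < a -> 0 < kappa ->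
  measurable_fun (horn a (2 * a)) g ->
  (forall z, horn a (2 * a) z -> ((kappa / z.1 ^+ n.+1)%:E <= g z)%E) ->
  ((kappa * tau / 2 ^+ n.+1)%:E <= \int[mu \x mu]_(z in horn a (2 * a)) g z)%E.
Proof.
move=> a0 kappa0 mg g_ge; pose m := kappa / (2 * a) ^+ n.+1.
have m0 : 0 <= m.
  by rewrite divr_ge0 ?exprn_ge0 ?mulr_ge0 ?(ltW kappa0) ?(ltW a0).
apply: (@le_trans _ _ (\int[mu \x mu]_(z in horn a (2 * a)) m%:E)%E);
  last first.
  apply: ge0_le_integral => //; first exact: measurable_horn.
  move=> z z_horn; apply: le_trans (g_ge z z_horn); rewrite lee_fin.
  have [/andP[az za] _] := z_horn; have z0 : 0 < z.1 := lt_trans a0 az.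
  rewrite ler_wpM2l ?(ltW kappa0) // lef_pV2 ?posrE ?exprn_gt0 ?mulr_gt0 //.
  by rewrite lerXn2r ?nnegrE ?mulr_ge0 // ltW.
rewrite integral_cst //=; last exact: measurable_horn.
apply: (@le_trans _ _ (m%:E * (tau * a ^+ n * (2 * a - a))%:E)%E); last first.
  apply: lee_wpmul2l; rewrite ?lee_fin //; apply: measure_horn_ge;
    first exact: ltW.
  lra.
rewrite -EFinM lee_fin le_eqVlt; apply/orP; left; apply/eqP.
rewrite /m exprMn -[2 * a - a]/(2 * a - a) (_ : 2 * a - a = a); last by lra.
rewrite -mulrA -mulrA -exprSr; field.
by rewrite !expf_neq0 ?gt_eqF.
Qed.

Lemma integral_horn_pinfty x0 kappa (U : set (R * R)) (g : R * R -> \bar R) :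
  0 < x0 -> 0 < kappa -> measurable U -> measurable_fun U g ->
  (forall z, U z -> (0 <= g z)%E) -> horn 0 x0 `<=` U ->
  (forall z, horn 0 x0 z -> ((kappa / z.1 ^+ n.+1)%:E <= g z)%E) ->
  (\int[mu \x mu]_(z in U) g z = +oo)%E.
Proof.
move=> x00 kappa0 mU mg g0 hornU g_ge; pose a k := x0 / 2 ^+ k.
have a0 k : 0 < a k by rewrite divr_gt0 ?exprn_gt0.
have aS k : a k = 2 * a k.+1.
  by rewrite /a exprS invfM [RHS]mulrCA [2 * _]mulrA divff // mul1r.
have a_le k l : (k <= l)%N -> a l <= a k.
  move=> kl; rewrite /a ler_wpM2l ?(ltW x00) // lef_pV2 ?posrE ?exprn_gt0 //.
  by rewrite ler_eXn2l // ltr1n.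
pose H k := horn (a k.+1) (a k).
have H_horn k : H k `<=` horn 0 x0.
  move=> z [/andP[az za] hz]; split=> //; rewrite (lt_trans (a0 k.+1)) //=.
  by rewrite (le_trans za) // (le_trans (a_le 0%N k _)) // /a expr0 divr1.
have HU k : H k `<=` U by move=> z /H_horn/hornU.
apply: (ge0_integral_pinfty_bigcup (mu := (mu \x mu)%E)
  (e := kappa * tau / 2 ^+ n.+1) mU mg g0 _ HU) => //.
- by move=> k; exact: measurable_horn.
- move=> k l _ _ [z [[/andP[k_z z_k] _] [/andP[l_z z_l] _]]].
  apply/eqP; rewrite eqn_leq; apply/andP; split;
    rewrite leqNgt; apply/negP => /a_le a_kl.
    by have := lt_le_trans l_z (le_trans z_k a_kl); rewrite ltxx.
  by have := lt_le_trans k_z (le_trans z_l a_kl); rewrite ltxx.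
- by rewrite divr_gt0 ?mulr_gt0 ?exprn_gt0.
move=> k; rewrite /H [a k]aS; apply: integral_horn_ge => //; rewrite -aS.
  exact: measurable_funS mU (@HU k) mg.
by move=> z /H_horn; exact: g_ge.
Qed.

End Horn.

Section HornCriterion.
Variables (R : realType) (q : {poly R}) (n : nat) (tau : R).
Hypotheses (tau0 : 0 < tau) (n0 : (0 < n)%N) (q0 : q`_0 = 0).

Lemma near_horn_box e : 0 < e -> \forall x \near (0 : R)^'+,
  forall t, tau <= t <= 2 * tau -> box e (x, x ^+ n * t - q.[x]).
Proof.
move=> e0; have e2 : 0 < e / 2 by rewrite divr_gt0.
near=> x => t /andP[tau_t t_tau].
have x0 : 0 < x by [].
have x1 : x <= 1 by near: x; exact: nbhs_right_le.
have qx : `|q.[x]| < e / 2.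
  near: x; apply: cvgr0_norm_lt e2; apply: cvg_at_right_filter.
  by have := @continuous_horner _ q (0 : R);
    rewrite /continuous_at horner_coef0 q0.
have xt : x * (2 * tau) < e / 2.
  by rewrite -ltr_pdivlMr ?mulr_gt0 //; near: x; apply: nbhs_right_lt;
    rewrite !divr_gt0 ?mulr_gt0.
split; first by rewrite /= gtr0_norm //; near: x; exact: nbhs_right_lt.
apply: le_lt_trans (ler_normB _ _) _.
have : `|x ^+ n * t| <= x * (2 * tau).
  rewrite normrM normrX (gtr0_norm x0) (gtr0_norm (lt_le_trans tau0 tau_t)).
  rewrite ler_pM ?exprn_ge0 ?(ltW x0) ?(le_trans (ltW tau0)) //.
  by rewrite -[leRHS]expr1 ler_wiXn2l // ltW.
lra.
Unshelve. all: by end_near. Qed.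

Lemma Lp_loc_subcritical (p kappa : R) (s : nat) (f : R * R -> R[i]) :
  0 < p -> 0 < kappa ->
  (\forall x \near (0 : R)^'+, forall t, tau <= t <= 2 * tau ->
    kappa <= x ^+ s * cmod (f (x, x ^+ n * t - q.[x]))) ->
  Lp_loc p f -> subcritical p n s.
Proof.
move=> p0 kappa0 f_ge [U [[e [e0 eU]] [mU [fr [fi fin]]]]].
apply: contraT; rewrite /subcritical -leNgt => supercritical.
have : \forall x \near (0 : R)^'+, x <= 1 /\ forall t, tau <= t <= 2 * tau ->
    box e (x, x ^+ n * t - q.[x]) /\
    kappa <= x ^+ s * cmod (f (x, x ^+ n * t - q.[x])).
  near=> x; split; first by near: x; exact: nbhs_right_le.
  move=> t t_tau; split; move: t t_tau; near: x;
    [exact: near_horn_box|exact: f_ge].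
move=> /near_right0_itv[d d0 dP].
have hornP z : horn q n tau 0 d z -> [/\ 0 < z.1, z.1 <= 1, box e z &
    kappa <= z.1 ^+ s * cmod (f z)].
  move=> hz; have [t t_tau zE] := horn_param (lexx 0) hz; have [z0d _] := hz.
  have [z1 /(_ t t_tau)] := dP _ z0d; rewrite -zE => -[? ?].
  by have /andP[] := z0d.
suff int_pinfty : (\int[lebesgue_measure \x lebesgue_measure]_(z in U)
    ((cmod (f z)) `^ p)%:E = +oo)%E by move: fin; rewrite int_pinfty ltxx.
apply: (@integral_horn_pinfty R q n tau tau0 d (kappa `^ p)) => //.
- by rewrite powR_gt0.
- exact: measurable_cmod_powR.
- by move=> z _; rewrite lee_fin powR_ge0.
- by move=> z /hornP[_ _ /eU].
move=> z /hornP[z0 z1 _ f_ge_z];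
  rewrite lee_fin ler_pdivrMr ?exprn_gt0 // mulrC.
apply: (@le_trans _ _ ((z.1 ^+ s * cmod (f z)) `^ p)).
  by rewrite ge0_ler_powR ?nnegrE ?mulr_ge0 ?exprn_ge0 ?cmod_ge0 ?(ltW z0)
    ?(ltW p0) ?(ltW kappa0).
rewrite powRM ?exprn_ge0 ?cmod_ge0 ?(ltW z0) // ler_wpM2r ?powR_ge0 //.
rewrite -!powR_mulrn ?(ltW z0) // -powRrM.
by apply: ger_powR; rewrite ?z0.
Unshelve. all: by end_near. Qed.

End HornCriterion.

(** * The order along a branch *)

Section Divisibility.
Variables (R : realType) (n : nat) (q : {poly R}) (Q : cpseries R).
Hypotheses (q0 : q`_0 = 0) (cQ : ps_convergent Q).

Lemma blowup_part_eval : exists2 s, 0 < s &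
  forall b, absconv (blowup_series n q (part b Q)) s /\
    forall x y, `|x| <= s -> `|y| <= s ->
      reval (blowup_series n q (part b Q)) x y =
        reval (part b Q) x (x ^+ n * y - q.[x]).
Proof.
have [r r0 cr] := absconv_part cQ.
have /choice[s sP] b := blowup_series_eval n r0 (cr b) q0.
have s0 b : 0 < s b by have [] := sP b.
exists (Num.min (s false) (s true)) => [|b]; first by rewrite lt_min !s0.
have s_le : Num.min (s false) (s true) <= s b
  by case: b; rewrite ge_min lexx ?orbT.
have [_ cs evs] := sP b; split=> [|x y xs ys].
  by apply: absconv_le cs; rewrite !ger0_norm ?le_min ?(ltW (s0 _)).
by apply: evs; exact: le_trans s_le.
Qed.

Lemma xpow_dividesP k : xpow_divides k n q Q <->
  forall b a a', (a < k)%N -> blowup_series n q (part b Q) a a' = 0.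
Proof.
have [s s0 evs] := blowup_part_eval.
split=> [[G [cG [e [e0 QG]]]] b a a' ak|coef0].
  have [cs evsb] := evs b; have [r r0 cr] := absconv_part cG.
  have [K K0 GK] := reval_bounded r0 (cr b).
  apply: (coef_eq0_of_bound (k := k) (K := K) a' s0 cs _ ak).
  apply/near0_boxP; exists (Num.min s (Num.min e r));
    first by rewrite !lt_min s0 e0.
  move=> [x y] [] /=; rewrite !lt_min => /and3P[xs xe xr] /and3P[ys ye yr].
  rewrite evsb ?(ltW xs) ?(ltW ys) //.
  have -> : reval (part b Q) x (x ^+ n * y - q.[x]) =
    x ^+ k * reval (part b G) x y.
    have := QG x y xe ye; rewrite !ps_evalE => QGxy.
    by case: b {cs evsb GK}; [have := congr1 (@complex.Im R) QGxy|
      have := congr1 (@complex.Re R) QGxy]; rewrite /= mul0r ?addr0 ?subr0.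
  by rewrite normrM normrX mulrC ler_wpM2r ?exprn_ge0 // GK //; exact: ltW.
pose G b := row_shift k (blowup_series n q (part b Q)).
pose G' : cpseries R := fun i j => (G false i j +i* G true i j)%C.
have partG b : part b G' = G b by case: b.
exists G'; split.
  apply: (ps_convergent_part s0) => b; rewrite partG.
  have [cs _] := evs b; exact: (absconv_row_shift s0 cs (coef0 b)).
exists s; split=> // x y /ltW xs /ltW ys.
have partE b : reval (part b Q) x (x ^+ n * y - q.[x]) =
  x ^+ k * reval (part b G') x y.
  have [cs evsb] := evs b.
  by rewrite -evsb // (reval_row_shift s0 cs (coef0 b)) // partG.
by rewrite !ps_evalE !partE /=; congr Complex; rewrite !mul0r ?subr0 ?addr0.
Qed.

Lemma le_OnqP (z : int) :
  (z%:~R%:E <= Onq n q Q)%E <-> exists2 k, xpow_divides k n q Q & z <= k%:Z.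
Proof.
split=> [z_le|[k dk zk]]; last first.
  apply: (@le_trans _ _ k%:R%:E); first by rewrite lee_fin pmulrn ler_int.
  by apply: ereal_sup_ubound; exists k.
apply: contrapT => no_k; move: z_le; rewrite leNgt => /negP; apply.
apply: (@le_lt_trans _ _ (z - 1)%:~R%:E); last by rewrite lte_fin ltr_int; lia.
apply: ge_ereal_sup => _ [k dk <-]; rewrite lee_fin pmulrn ler_int.
by rewrite -ltzD1 subrK ltNge; apply/negP => zk; apply: no_k; exists k.
Qed.

Variables (p : R) (S : nat).
Hypothesis p0 : 0 < p.

Lemma subcritical_ceil k :
  subcritical p n (S - k) = (S%:Z - Num.ceil ((n + 1)%:R / p) + 1 <= k%:Z).
Proof.
rewrite /subcritical -ltr_pdivlMr // -addn1 [(S - k)%:R]pmulrn -ceil_gt_int.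
have : 0 < Num.ceil ((n + 1)%:R / p)
  by rewrite ceil_gt_int mulr0z divr_gt0 // ltr0n addn1.
move: (Num.ceil _) => c c0; have [Sk|kS] := leqP S k.
  by rewrite (eqP Sk) c0; apply/esym; lia.
by rewrite -subzn 1?ltnW //; apply/idP/idP; lia.
Qed.

Lemma le_Onq_subcritical :
  ((S%:R - (Num.ceil ((n + 1)%:R / p))%:~R + 1)%:E <= Onq n q Q)%E <->
  forall b a a', blowup_series n q (part b Q) a a' != 0 ->
    subcritical p n (S - a).
Proof.
have -> : S%:R - (Num.ceil ((n + 1)%:R / p))%:~R + 1 =
    (S%:Z - Num.ceil ((n + 1)%:R / p) + 1)%:~R :> R.
  by rewrite !mulrzDr mulrNz -pmulrn.
rewrite le_OnqP; split=> [[k /xpow_dividesP coef0] | sub].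
  rewrite -subcritical_ceil => sub b a a'; have [/coef0 ->|ka] := ltnP a k.
    by rewrite eqxx.
  by move=> _; apply: subcritical_le sub; rewrite ?leq_sub2l ?ltW.
have exk : exists k, subcritical p n (S - k)
  by exists S; rewrite subnn subcritical0.
case: (ex_minnP exk) => k sub_k k_min; exists k;
  last by rewrite -subcritical_ceil.
apply/xpow_dividesP => b a a' ak; apply/eqP; apply: contraTT ak => /sub /k_min.
by rewrite -leqNgt.
Qed.

End Divisibility.

Section Branches.
Variables (R : realType) (M : nat) (L : 'I_M -> nat) (q : 'I_M -> {poly R}).
Variables (p : R) (Q : cpseries R).
Hypotheses (L0 : forall j, (0 < L j)%N) (q0 : forall j, (q j)`_0 = 0)
  (p1 : 1 <= p).
Hypothesis cQ : ps_convergent Q.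

Let p0 : 0 < p := lt_le_trans ltr01 p1.

Lemma Lp_loc_blowup_subcritical j b a a' :
  Lp_loc p (fun z => ps_eval Q z.1 z.2 / Pval L q z.1 z.2) ->
  blowup_series (2 * L j) (q j) (part b Q) a a' != 0 ->
  subcritical p (2 * L j) (\sum_(i < M) Oij L q i j - a).
Proof.
move=> QP nz.
set S := (\sum_(i < M) Oij L q i j)%N; set n := (2 * L j)%N in nz *.
have [Sa|aS] := leqP S a; first by rewrite (eqP Sa) subcritical0.
have n0 : (0 < n)%N by rewrite muln_gt0 L0.
have [s s0 /(_ b)[cs evs]] := blowup_part_eval n (q0 j) cQ.
have e0 : 0 < Num.min (s / 2) (1 / 2) by rewrite lt_min !divr_gt0.
have [tau [gamma [tau0 + gamma0 low]]] := reval_lower_bound s0 e0 cs nz.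
rewrite le_min => /andP[tau_s tau_1].
have [C C0 P_le] := Pval_upper_bound L q j.
apply: (Lp_loc_subcritical tau0 n0 (q0 j) (kappa := gamma / C) p0 _ _ QP);
  rewrite ?divr_gt0 //.
near=> x => t t_tau; have /andP[tau_t t_tau2] := t_tau.
have x0 : 0 < x by [].
have nx : `|x| = x := gtr0_norm x0.
have nt : `|t| = t := gtr0_norm (lt_le_trans tau0 tau_t).
have x1 : x <= 1 by near: x; exact: nbhs_right_le.
have xs : x <= s by near: x; exact: nbhs_right_le.
rewrite /= cmod_div.
set Qx := cmod (ps_eval Q _ _); set Px := cmod (Pval L q _ _).
have Q_ge : gamma * x ^+ a <= Qx.
  apply: le_trans (norm_reval_part_le b _ _ _).
  rewrite -evs ?nx ?nt //; last lra.
  by move: t t_tau {tau_t t_tau2 nt Qx Px}; near: x.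
have P_le_x : Px <= C * x ^+ S.
  by rewrite -nx; apply: P_le; rewrite ?nx ?nt //; lra.
have P0 : 0 < Px.
  rewrite /Px (cmod_Pval L q (x, _)); apply: prodr_gt0 => i _.
  by apply: lt_le_trans (Xn_le_factor _ _ _ _); rewrite /= nx exprn_gt0.
rewrite mulrA ler_pdivlMr // mulrAC ler_pdivrMr //.
apply: (@le_trans _ _ (gamma * (C * x ^+ S)));
  first by rewrite ler_wpM2l // ltW.
have -> : x ^+ S = x ^+ (S - a) * x ^+ a by rewrite -exprD subnK // ltnW.
have -> : gamma * (C * (x ^+ (S - a) * x ^+ a)) =
  x ^+ (S - a) * (gamma * x ^+ a) * C by ring.
by rewrite ler_wpM2r ?(ltW C0) // ler_wpM2l ?exprn_ge0 // ltW.
Unshelve. all: by end_near. Qed.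

Lemma scale_sum_end j :
  scale_sum (Oij L q) (2 * L j) j = (\sum_(i < M) Oij L q i j)%N.
Proof. by apply: eq_bigr => i _; apply/minn_idPl; exact: Oij_le_r. Qed.

(* Truncating [c] to a polynomial preserves the low-order coefficients of
   [c(x, y - q_j(x))], and those of high order give no constraint. *)
Lemma subcritical_branch_series (c : nat -> nat -> R) :
  (forall j a a', blowup_series (2 * L j) (q j) c a a' != 0 ->
    subcritical p (2 * L j) (\sum_(i < M) Oij L q i j - a)) ->
  forall j m a a', (m <= 2 * L j)%N -> branch_series (q j) c a a' != 0 ->
    subcritical p m (scale_sum (Oij L q) m j - (a + m * a')).
Proof.
move=> sub j m a a' mL nz.
pose S := (\sum_i 2 * L i)%N; pose D := (S + a + a').+1.
have coefD i b b' : (b + b' < D)%N ->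
    (branch q (trunc D c) i)`_b'`_b = branch_series (q i) c b b'.
  by move=> bD; rewrite /branch coef_trunc_branch.
apply: (subcritical_scale p1 (leq_Oij L q) (C := trunc D c)) => //; last first.
  by rewrite coefD // /D; lia.
move=> i b b'; rewrite scale_sum_end; have [bD|Db] := ltnP (b + b') D.
  by rewrite coefD // -(blowup_series_coef (2 * L i) c b b' (q0 i)); exact: sub.
have O_le : (\sum_(l < M) Oij L q l i <= S)%N
  by apply: leq_sum => l _; exact: Oij_le_l.
have Li := L0 i.
have -> : (\sum_(l < M) Oij L q l i - (b + 2 * L i * b') = 0)%N
  by rewrite /D in Db; nia.
by rewrite subcritical0.
Qed.

End Branches.

Theorem theorem1p4 (R : realType) (M : nat) (L : 'I_M -> nat)
    (q : 'I_M -> {poly R}) (p : R) (Q : cpseries R) :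
  (1 <= M)%N ->
  (forall j, (1 <= L j)%N) ->
  (forall j, (size (q j) <= 2 * L j)%N) ->
  (forall j, (q j).[0] = 0) ->
  1 <= p ->
  ps_convergent Q ->
  (Lp_loc p (fun z => ps_eval Q z.1 z.2 / Pval L q z.1 z.2) <->
   forall j : 'I_M,
     (((\sum_(i < M) Oij L q i j)%:R - (Num.ceil ((2 * L j + 1)%:R / p))%:~R + 1)%:E
       <= Onq (2 * L j) (q j) Q)%E).
Proof.
move=> M0 L0 _ qh p1 cQ.
have p0 : 0 < p := lt_le_trans ltr01 p1.
have q0 j : (q j)`_0 = 0 by rewrite -horner_coef0 qh.
have order_cond j := le_Onq_subcritical (2 * L j) (q0 j) cQ
  (\sum_(i < M) Oij L q i j) p0.
split=> [QP j|H].
  by apply/order_cond => b a a'; exact: Lp_loc_blowup_subcritical.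
apply: Lp_loc_of_subcritical => // b.
apply: subcritical_branch_series => // j a a'.
by have /order_cond := H j; apply.
Qed.
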